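(* Let $(\mathcal{B},\mathcal{L},\theta,\mathcal{I}_\alpha)$ be a generalized Boolean dynamical system, $\mathsf{T}$ the tight spectrum of its inverse semigroup and $\partial E$ the boundary path space of its topological correspondence. Then there exists a homeomorphism $\phi:\mathsf{T}\to\partial E$ such that $\phi\circ\sigma=\sigma_E\circ\phi|_{\mathsf{T}^{(1)}}$.
   Context: **Generalized Boolean dynamical systems.** A Boolean algebra $\mathcal{B}$ is a (not necessarily unital) relatively complemented distributive lattice with least element $\emptyset$ and operations $\cap,\cup,\setminus$; $A\subseteq B$ means $A\cap B=A$. An ideal is a non-empty subset closed under finite unions and under intersection with arbitrary elements of $\mathcal{B}$. An action is a map $\mathcal{B}\to\mathcal{B}$ preserving $\cap,\cup,\setminus$ and $\emptyset$. A generalized Boolean dynamical system $(\mathcal{B},\mathcal{L},\theta,\mathcal{I}_\alpha)$ consists of a Boolean algebra $\mathcal{B}$, a set $\mathcal{L}$, actions $\{\theta_\alpha\}_{\alpha\in\mathcal{L}}$ and ideals $\{\mathcal{I}_\alpha\}_{\alpha\in\mathcal{L}}$ with $\{A\in\mathcal{B}:A\subseteq\theta_\alpha(B)\text{ for some }B\in\mathcal{B}\}\subseteq\mathcal{I}_\alpha$ for all $\alpha\in\mathcal{L}$. **Words.** $\mathcal{L}^*$: finite words over $\mathcal{L}$ (including the empty word $\emptyset$); $\mathcal{L}^\infty$: infinite words; $|\alpha|$: length; $\alpha_{i,j}=\alpha_i\cdots\alpha_j$ (empty if $j<i$). For $\alpha=\alpha_1\cdots\alpha_n$: $\theta_\alpha=\theta_{\alpha_n}\circ\cdots\circ\theta_{\alpha_1}$,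 $\theta_\emptyset=\mathrm{Id}$; $\mathcal{I}_\alpha=\{A\in\mathcal{B}:A\subseteq\theta_{\alpha_2\cdots\alpha_n}(B)\text{ for some }B\in\mathcal{I}_{\alpha_1}\}$ for $n\ge1$, $\mathcal{I}_\emptyset=\mathcal{B}$. $\mathcal{W}^*=\{\alpha\in\mathcal{L}^*:\mathcal{I}_\alpha\neq\{\emptyset\}\}$, $\mathcal{W}^\infty=\{\alpha\in\mathcal{L}^\infty:\alpha_{1,n}\in\mathcal{W}^*\ \forall n\geq1\}$, $\mathcal{W}^{\leq\infty}=\mathcal{W}^*\cup\mathcal{W}^\infty$. **Inverse semigroup.** $S=\{(\alpha,A,\beta):\alpha,\beta\in\mathcal{L}^*,\ \emptyset\neq A\in\mathcal{I}_\alpha\cap\mathcal{I}_\beta\}\cup\{0\}$, with $0$ absorbing and $(\alpha,A,\beta)(\gamma,B,\delta)$ equal to $(\alpha,A\cap B,\delta)$ if $\beta=\gamma$; $(\alpha\gamma',\theta_{\gamma'}(A)\cap B,\delta)$ if $\gamma=\beta\gamma'$; $(\alpha,A\cap\theta_{\beta'}(B),\delta\beta')$ if $\beta=\gamma\beta'$ (interpreted as $0$ when the middle entry is $\emptyset$); $0$ otherwise. Its semilattice of idempotents is $E(S)=\{(\alpha,A,\alpha):\emptyset\neq A\in\mathcal{I}_\alpha\}\cup\{0\}$, ordered by $e\le f$ iff $ef=e$. **Tight spectrum.** A filter in a poset with least element is a non-empty, upward closed, downward directed subset not containing the least element; an ultrafilter is a maximal filter. Each filter $\xi$ in $E(S)$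 has an associated word $\alpha\in\mathcal{W}^{\leq\infty}$ (the longest first entry of elements of $\xi$, or the infinite word of which all first entries of elements of $\xi$ are beginnings if their lengths are unbounded); write $\xi=\xi^\alpha$ and $\xi_n=\{A\in\mathcal{I}_{\alpha_{1,n}}:(\alpha_{1,n},A,\alpha_{1,n})\in\xi\}$, $0\le n\le|\alpha|$, $n<\infty$; $\xi$ is determined by $\alpha$ and $\{\xi_n\}_n$. A finite $Z\subseteq\{y\in E(S):y\le x\}$ is a cover for $x$ if every $0\neq y\le x$ satisfies $yz\neq0$ for some $z\in Z$; $\xi$ is tight if $Z\cap\xi\neq\emptyset$ for each $x\in\xi$ and each finite cover $Z$ of $x$. $\mathsf{T}$ is the set of tight filters with the topology of pointwise convergence of characteristic functions (subspace of $\{0,1\}^{E(S)}$). $\mathsf{T}^{(1)}=\{\xi^\alpha\in\mathsf{T}:|\alpha|\ge1\}$, and $\sigma:\mathsf{T}^{(1)}\to\mathsf{T}$ sends $\xi^{\alpha}$ with $\alpha=\alpha_1\gamma$, $\alpha_1\in\mathcal{L}$, to the (tight) filter $\eta$ with associated word $\gamma$ and $\eta_n=\{B\in\mathcal{I}_{\gamma_{1,n}}:A\subseteq B\text{ for some }A\in\xi_{n+1}\}$, $0\le n\le|\gamma|$. **Topological correspondence.** For $\alpha\in\mathcal{L}^*$, $X_\alpha$ is the set of ultrafilters in the Boolean algebra $\mathcal{I}_\alpha$ with basis of open sets $\{\mathcal{F}\in X_\alpha:A\in\mathcal{F}\}$, $A\in\mathcal{I}_\alpha$. Put $E^0=X_\emptyset$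 (ultrafilters of $\mathcal{B}$), $F^0=X_\emptyset\cup\{\emptyset\}$, where $\emptyset$ is an isolated point if $\mathcal{B}$ is unital and $F^0$ is the one-point compactification of $X_\emptyset$ with $\emptyset$ at infinity otherwise. $E^1=\{e^\alpha_\eta:\alpha\in\mathcal{L},\eta\in X_\alpha\}$ with the disjoint union topology of $\bigsqcup_{\alpha\in\mathcal{L}}X_\alpha$. $d:E^1\to E^0$, $d(e^\alpha_\eta)=\{B\in\mathcal{B}:A\subseteq B\text{ for some }A\in\eta\}$; $r:E^1\to F^0$, $r(e^\alpha_\eta)=\{A\in\mathcal{B}:\theta_\alpha(A)\in\eta\}$ (an ultrafilter or $\emptyset$). **Boundary path space.** $F^0_{sce}=F^0\setminus\overline{r(E^1)}$; $F^0_{fin}$ is the set of $v\in F^0$ having a neighborhood $V$ with $r^{-1}(V)$ compact; $F^0_{rg}=F^0_{fin}\setminus\overline{F^0_{sce}}$; $F^0_{sg}=F^0\setminus F^0_{rg}$; $E^0_{sg}=F^0_{sg}\cap E^0$. For $n\ge2$, $E^n=\{(e_1,\dots,e_n)\in(E^1)^n:d(e_i)=r(e_{i+1}),1\le i<n\}$ (subspace of the product), $E^*=\bigsqcup_{n\ge0}E^n$ (disjoint union topology), $E^\infty=\{(e_i)_{i\ge1}:d(e_i)=r(e_{i+1})\ \forall i\}$. For a path of positive length $r(\mu)=r(\mu_1)$, and $d(\mu)=d(\mu_n)$ if it has finite length $n$; for $v\in E^0$, $r(v)=d(v)=v$. $\partial E=E^\infty\sqcup\{\mu\in E^*:d(\mu)\in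 E^0_{sg}\}$. For $Q\subseteq E^*$ (here $r(\mu)\in Q$ refers to $Q\cap E^0$), $\mathcal{Z}(Q)=\{\mu\in\partial E:r(\mu)\in Q\text{ or }\mu_1\cdots\mu_i\in Q\text{ for some }1\le i\le|\mu|\}$. $\partial E$ has the topology generated by the sets $\mathcal{Z}(U)\cap\mathcal{Z}(K)^c$, $U\subseteq E^*$ open, $K\subseteq E^*$ compact. The shift $\sigma_E:\partial E\setminus E^0_{sg}\to\partial E$ removes the first edge of paths of length $\geq2$, and $\sigma_E(\mu)=d(\mu)$ for $|\mu|=1$. *)

(* Defs.v *)
From HB Require Import structures.
From mathcomp Require Import all_boot all_order.
From mathcomp Require Import zify.
From mathcomp Require Import boolp classical_sets functions cardinality topology.

Set Implicit Arguments.
Unset Strict Implicit.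
Unset Printing Implicit Defensive.

Import Order.Theory.
Local Open Scope classical_set_scope.
Local Open Scope order_scope.

(* The poset is the subset [P] of [T], ordered by [le], with least element
   [bot]. *)
Definition poset_filter (T : Type) (P : set T) (le : rel T) (bot : T)
    (F : set T) : Prop :=
  [/\ F `<=` P, F !=set0,
      forall x y, F x -> P y -> le x y -> F y,
      forall x y, F x -> F y -> exists z, [/\ F z, le z x & le z y]
    & ~ F bot].

Definition poset_ultrafilter (T : Type) (P : set T) (le : rel T) (bot : T)
    (F : set T) : Prop :=
  poset_filter P le bot F /\
  forall F', poset_filter P le bot F' -> F `<=` F' -> F' = F.

Definition is_ideal (disp : Order.disp_t) (B : cbDistrLatticeType disp)
    (J : set B) : Prop :=
  [/\ J !=set0, forall x y, J x -> J y -> J (x `|` y)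
    & forall x y, J x -> J (x `&` y)].

Definition is_action (disp : Order.disp_t) (B : cbDistrLatticeType disp)
    (f : B -> B) : Prop :=
  [/\ {morph f : x y / x `&` y}, {morph f : x y / x `|` y},
      {morph f : x y / x `\` y} & f \bot = \bot].

Record gbds (disp : Order.disp_t) (B : cbDistrLatticeType disp)
    (L : choiceType) := GBDS {
  theta : L -> B -> B;
  ideal : L -> set B;
  theta_action : forall a, is_action (theta a);
  ideal_ideal : forall a, is_ideal (ideal a);
  range_ideal : forall a, [set x | exists y, x <= theta a y] `<=` ideal a }.

Inductive word (L : Type) := Fin of seq L | Inf of nat -> L.

Definition word_size_ge (L : Type) (n : nat) (w : word L) : bool :=
  match w with Fin s => (n <= size s)%N | Inf _ => true end.

Definition word_take (L : Type) (n : nat) (w : word L) : seq L :=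
  match w with Fin s => take n s | Inf f => mkseq f n end.

Definition word_cons (L : Type) (a : L) (w : word L) : word L :=
  match w with
  | Fin s => Fin (a :: s)
  | Inf f => Inf (fun n => if n is m.+1 then f m else a)
  end.

Section GBDS.
Context {disp : Order.disp_t} {B : cbDistrLatticeType disp} {L : choiceType}.
Variable G : gbds B L.

Definition theta_word (s : seq L) (x : B) : B :=
  foldl (fun y a => theta G a y) x s.

Definition ideal_word (s : seq L) : set B :=
  if s is a :: s' then
    [set x | exists2 y, ideal G a y & x <= theta_word s' y]
  else setT.

Lemma theta_word_cat s t x :
  theta_word (s ++ t) x = theta_word t (theta_word s x).
Proof. exact: foldl_cat. Qed.

Lemma theta_word_action s : is_action (theta_word s).
Proof.
elim: s => [//|a s [hI hU hD h0]].
by have [aI aU aD a0] := theta_action G a; split=> [x y|x y|x y|];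
  rewrite /= ?(aI, aU, aD, a0) ?hI ?hU ?hD.
Qed.

Lemma theta_word_le s : {homo theta_word s : x y / x <= y}.
Proof.
have [hI _ _ _] := theta_word_action s.
by move=> x y /meet_idPl xy; rewrite leEmeet -hI xy.
Qed.

Lemma is_ideal_le (J : set B) x y : is_ideal J -> J x -> y <= x -> J y.
Proof. by case=> _ _ hI Jx /meet_idPr <-; exact: hI. Qed.

Lemma ideal_word_ideal s : is_ideal (ideal_word s).
Proof.
case: s => [|a s]; first by split=> //; exists \bot.
have [[x Jx] hU hI] := ideal_ideal G a.
have [_ tU _ _] := theta_word_action s.
split; first by exists (theta_word s x), x.
- move=> y z [y' Jy yy'] [z' Jz zz']; exists (y' `|` z'); first exact: hU.
  by rewrite tU leU2.
- by move=> y z [y' Jy yy']; exists y' => //; apply: le_trans yy'; exact: leIl.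
Qed.

Lemma ideal_word1 a : ideal_word [:: a] = ideal G a.
Proof.
apply/seteqP; split=> x /=; last by exists x.
by case=> y Jy; exact: is_ideal_le (ideal_ideal G a) Jy.
Qed.

Lemma ideal_word_cat s t x :
  ideal_word s x -> ideal_word (s ++ t) (theta_word t x).
Proof.
case: s => [|a s] /=; last first.
  by case=> y Jy xy; exists y => //; rewrite theta_word_cat theta_word_le.
case: t => [|b t] //= _; exists (theta G b x) => //.
by apply: range_ideal; exists x.
Qed.

Lemma ideal_word_catP a s t x : ideal_word (a :: s ++ t) x ->
  exists2 y, ideal_word (a :: s) y & x <= theta_word t y.
Proof.
case=> y Jy; rewrite theta_word_cat => xy.
by exists (theta_word s y) => //; exists y.
Qed.

Lemma ideal_word_behead a s : ideal_word (a :: s) `<=` ideal_word s.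
Proof.
move=> x [y _ xy]; apply: is_ideal_le (ideal_word_ideal s) _ xy.
exact: (@ideal_word_cat [::]).
Qed.

(* [None] is the zero element. *)
Definition triple : Type := option (seq L * B * seq L).

Definition inverse_semigroup : set triple :=
  [set e | if e is Some (a, x, b)
           then [/\ x != \bot, ideal_word a x & ideal_word b x] else True].

Definition triple_norm (a : seq L) (x : B) (b : seq L) : triple :=
  if x == \bot then None else Some (a, x, b).

Definition smul (e f : triple) : triple :=
  match e, f with
  | Some (a, x, b), Some (c, y, d) =>
    if b == c then triple_norm a (x `&` y) d
    else if prefix b c then
      let c' := drop (size b) c in
      triple_norm (a ++ c') (theta_word c' x `&` y) d
    else if prefix c b then
      let b' := drop (size c) b in
      triple_norm a (x `&` theta_word b' y) (d ++ b')
    else None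
  | _, _ => None
  end.

Definition idem (a : seq L) (x : B) : triple := Some (a, x, a).

Definition idempotents : set triple :=
  [set e | e = None \/
    exists a x, [/\ x != \bot, ideal_word a x & e = idem a x]].

Definition sle : rel triple := fun e f => smul e f == e.

Definition is_cover (x : triple) (Z : set triple) : Prop :=
  [/\ finite_set Z, Z `<=` [set y | idempotents y /\ sle y x]
    & forall y, idempotents y -> y <> None -> sle y x ->
        exists2 z, Z z & smul y z <> None].

Definition efilter (xi : set triple) : Prop :=
  poset_filter idempotents sle None xi.

Definition tight : set (set triple) :=
  [set xi | efilter xi /\
            forall x Z, xi x -> is_cover x Z -> Z `&` xi !=set0].

Definition tight_spectrum : Type := set_type tight.

HB.instance Definition _ := Choice.on tight_spectrum.

Definition charfun (xi : tight_spectrum) :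
    {ptws set_type idempotents -> bool} :=
  fun e => `[< val xi (val e) >].

HB.instance Definition _ :=
  Topological.copy tight_spectrum (initial_topology charfun).

(* A word associated with a filter is automatically in $\mathcal{W}^{\leq\infty}$,
   since the middle entries of the nonzero idempotents are nonzero. *)
Definition assoc_word (xi : set triple) (w : word L) : Prop :=
  match w with
  | Fin s => (exists x, xi (idem s x)) /\
             forall t x, xi (idem t x) -> (size t <= size s)%N
  | Inf f => (forall n, exists t x, xi (idem t x) /\ (n <= size t)%N) /\
             forall t x, xi (idem t x) -> t = mkseq f (size t)
  end.

(* [slice xi w n] is $\xi_n$, for a filter [xi] with associated word [w]. *)
Definition slice (xi : set triple) (w : word L) (n : nat) : set B :=
  [set x | ideal_word (word_take n w) x /\ xi (idem (word_take n w) x)].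

Definition tight_spectrum1 : set tight_spectrum :=
  [set xi | exists2 w, assoc_word (val xi) w & word_size_ge 1 w].

(* The shift of a filter with associated word [a w], as a set of idempotents;
   see [shift_assoc_word] and [shift_slice]. *)
Definition shift_filter (xi : set triple) : set triple :=
  [set e | exists a w n y,
    [/\ assoc_word xi (word_cons a w), word_size_ge n w,
        ideal_word (word_take n w) y,
        exists2 x, slice xi (word_cons a w) n.+1 x & x <= y
      & e = idem (word_take n w) y]].

Lemma cat_nil_r (s t : seq L) : s = s ++ t -> t = [::].
Proof.
by rewrite -{1}[s]cats0 => /eqP; rewrite eqseq_cat// eqxx => /eqP.
Qed.

Lemma smul_idem_catr s t x y :
  smul (idem s x) (idem (s ++ t) y) =
  triple_norm (s ++ t) (theta_word t x `&` y) (s ++ t).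
Proof.
rewrite /smul /=; case: eqP => [st|_]; last by rewrite prefix_prefix drop_size_cat.
by rewrite (cat_nil_r st) cats0.
Qed.

Lemma smul_idem_catl s t x y :
  smul (idem (s ++ t) y) (idem s x) =
  triple_norm (s ++ t) (y `&` theta_word t x) (s ++ t).
Proof.
rewrite /smul /=; case: eqP => [st|nst].
  by rewrite (cat_nil_r (esym st)) /= !cats0.
case: ifP => [/size_prefix|_]; last by rewrite prefix_prefix drop_size_cat.
rewrite size_cat -{2}[size s]addn0 leq_add2l leqn0 => /nilP t0.
by case: nst; rewrite t0 cats0.
Qed.

Lemma smul_idem_neq0 s t x y : smul (idem s x) (idem t y) <> None ->
  (exists u, t = s ++ u) \/ (exists u, s = t ++ u).
Proof.
rewrite /smul /=; case: eqP => [->|_]; first by left; exists [::]; rewrite cats0.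
case: ifP => [/prefixP|_]; first by left.
by case: ifP => [/prefixP|_]; first by right.
Qed.

Lemma triple_norm_idem s x : x != \bot -> triple_norm s x s = idem s x.
Proof. by rewrite /triple_norm => /negPf ->. Qed.

Lemma sle_idemP s t x y : y != \bot ->
  sle (idem t y) (idem s x) <-> exists2 u, t = s ++ u & y <= theta_word u x.
Proof.
move=> y0; split; last first.
  move=> [u -> yx]; rewrite /sle smul_idem_catl; move/meet_idPl : yx => ->.
  by rewrite triple_norm_idem.
move=> /eqP e; have [] : (exists u, s = t ++ u) \/ (exists u, t = s ++ u).
  by apply: (@smul_idem_neq0 t s y x); rewrite e.
- move=> [u su]; move: e; rewrite su smul_idem_catr /triple_norm.
  case: ifP => // _ [tu e _]; exists [::]; first by rewrite cats0.
  by move: e; rewrite (cat_nil_r (esym tu)) /= => <-; exact: leIr.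
- move=> [u tu]; exists u => //; move: e; rewrite tu smul_idem_catl /triple_norm.
  by case: ifP => // _ [e]; rewrite -e leIr.
Qed.

Lemma idempotentsE e :
  idempotents e <-> inverse_semigroup e /\ smul e e = e.
Proof.
split=> [[->//|[s [x [x0 Jx ->]]]]|].
  by split=> //; rewrite /smul /= eqxx meetxx triple_norm_idem.
case: e => [[[s x] t]|]; last by left.
move=> [[x0 Js Jt]] e; right; exists s, x; split=> //; rewrite /idem.
suff -> : t = s by [].
move: e; rewrite /smul; case: eqP => // _; case: ifP => [/prefixP[u ->]|_].
  rewrite drop_size_cat// /triple_norm; case: ifP => // _ [e _].
  by rewrite (cat_nil_r (esym e)) cats0.
case: ifP => // /prefixP[u ->].
rewrite drop_size_cat// /triple_norm; case: ifP => // _ [_ e].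
by rewrite (cat_nil_r (esym e)) cats0.
Qed.

Lemma efilter_idem xi e : efilter xi -> xi e ->
  exists s x, [/\ x != \bot, ideal_word s x & e = idem s x].
Proof. by move=> [sub _ _ _ n0] xie; have [e0|//] := sub _ xie; rewrite e0 in xie. Qed.

Lemma efilter_idemP xi s x : efilter xi -> xi (idem s x) ->
  x != \bot /\ ideal_word s x.
Proof.
by move=> xiF xisx; have [t [y [y0 Jy [-> ->]]]] := efilter_idem xiF xisx.
Qed.

Lemma efilter_dir xi s t x y : efilter xi -> xi (idem s x) -> xi (idem t y) ->
  exists u z, [/\ xi (idem u z),
    exists2 v, u = s ++ v & z <= theta_word v x &
    exists2 v, u = t ++ v & z <= theta_word v y].
Proof.
move=> xiF xix xiy; have [_ _ _ xid _] := xiF.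
have [e [xie ex ey]] := xid _ _ xix xiy.
have [u [z [z0 _ ez]]] := efilter_idem xiF xie.
rewrite ez in xie ex ey; exists u, z; split=> //.
  exact/(sle_idemP _ _ _ z0).
exact/(sle_idemP _ _ _ z0).
Qed.

Lemma word_take_cons n a (w : word L) :
  word_take n.+1 (word_cons a w) = a :: word_take n w.
Proof.
by case: w => [//|f]; rewrite /= /mkseq /= (iotaDl 1 0 n) -map_comp.
Qed.

Lemma word_size_ge_cons n a (w : word L) :
  word_size_ge n.+1 (word_cons a w) = word_size_ge n w.
Proof. by case: w. Qed.

Lemma word_consP (w : word L) : word_size_ge 1 w -> exists a v, w = word_cons a v.
Proof.
case: w => [[//|a s] _|f _]; first by exists a, (Fin s).
by exists (f 0%N), (Inf (fun n => f n.+1)); congr Inf; apply/funext => -[].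
Qed.

Lemma assoc_word_take xi w t x : efilter xi -> assoc_word xi w ->
  xi (idem t x) -> word_size_ge (size t) w /\ t = word_take (size t) w.
Proof.
move=> xiF; case: w => [s [[y xiy] smax]|f [_ h]] xix; last by split=> //; exact: h xix.
split; first exact: smax xix.
have [u [z [xiz [v uv _] [v' uv' _]]]] := efilter_dir xiF xiy xix.
have /nilP v0 : nilp v.
  by have := smax _ _ xiz; rewrite uv size_cat -{2}[size s]addn0 leq_add2l leqn0.
by move: uv' => /=; rewrite uv v0 cats0 => ->; rewrite take_size_cat.
Qed.

Lemma shift_filterE xi a w e : efilter xi -> assoc_word xi (word_cons a w) ->
  shift_filter xi e <-> exists t y, [/\ ideal_word t y,
    exists2 x, xi (idem (a :: t) x) & x <= y & e = idem t y].
Proof.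
move=> xiF xiw; split=> [|[t [y [Jy [x xix xy] ->]]]].
- move=> [b [v [n [y [xiv nv Jy [x [Jx xix] xy] ->]]]]].
  exists (word_take n v), y; split=> //; exists x => //.
  rewrite word_take_cons in xix.
  by have [_] := assoc_word_take xiF xiw xix; rewrite /= word_take_cons => -[<-].
- have [tw tE] := assoc_word_take xiF xiw xix.
  move: tw tE; rewrite /= word_size_ge_cons word_take_cons => tw [tE].
  exists a, w, (size t), y; rewrite -tE; split=> //; exists x => //.
  by rewrite /slice /= word_take_cons -tE; have [_] := efilter_idemP xiF xix.
Qed.

Section Shift.
Variables (xi : set triple) (a : L) (w : word L).
Hypotheses (xiF : efilter xi) (xiw : assoc_word xi (word_cons a w)).

Let etaE e := shift_filterE e xiF xiw.

Lemma shift_efilter : efilter (shift_filter xi).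
Proof.
split.
- move=> e /etaE[t [y [Jy [x xix xy] ->]]]; right; exists t, y; split=> //.
  have [x0 _] := efilter_idemP xiF xix.
  by apply: contraNneq x0 => y0; rewrite -lex0 -y0.
- have [t [x xix]] : exists t x, xi (idem (a :: t) x).
    case: w xiw => [s [[x xix] _]|f [h1 h2]]; first by exists s, x.
    have [[|b t] [x [xix //]]] := h1 1%N.
    by have := h2 _ _ xix; rewrite /mkseq /= => -[ba _]; exists t, x; rewrite -ba.
  exists (idem t x); apply/etaE; exists t, x; split=> //; last by exists x.
  by apply: (@ideal_word_behead a); have [] := efilter_idemP xiF xix.
- move=> e e' /etaE[t [y [Jy [x xix xy] ->]]] [->|[s [y' [y'0 Jy' ->]]]].
    by rewrite /sle /=.
  have [x0 Jx] := efilter_idemP xiF xix.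
  have y0 : y != \bot by apply: contraNneq x0 => y0; rewrite -lex0 -y0.
  move=> /(sle_idemP _ _ _ y0)[u tE yy']; apply/etaE; rewrite tE in Jx xix.
  have [z Jz xz] := ideal_word_catP Jx.
  have [tI _ _ t0] := theta_word_action u.
  have xyz : x <= theta_word u (y' `&` z).
    by rewrite tI lexI xz andbT; apply: le_trans yy'.
  exists s, y'; split=> //; exists (y' `&` z); last exact: leIl.
  have [_ _ xile _ _] := xiF; apply: xile xix _ _.
    right; exists (a :: s), (y' `&` z); split=> //.
      by apply: contraNneq x0 => z0; rewrite -lex0 -t0 -z0.
    by apply: is_ideal_le (ideal_word_ideal (a :: s)) Jz _; exact: leIr.
  by apply/(sle_idemP _ _ _ x0); exists u.
- move=> e e' /etaE[t [y [Jy [x xix xy] ->]]] /etaE[t' [y' [Jy' [x' xix' xy'] ->]]].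
  have [u [z [xiz [v uv zx] [v' uv' zx']]]] := efilter_dir xiF xix xix'.
  have [z0 Jz] := efilter_idemP xiF xiz.
  exists (idem (t ++ v) z); split.
  + apply/etaE; exists (t ++ v), z; split=> //.
      by apply: (@ideal_word_behead a); rewrite uv in Jz.
    by exists z => //; rewrite uv in xiz.
  + by apply/(sle_idemP _ _ _ z0); exists v => //; apply: le_trans zx _; exact: theta_word_le.
  + apply/(sle_idemP _ _ _ z0); exists v'; first by move: uv'; rewrite uv => -[].
    by apply: le_trans zx' _; exact: theta_word_le.
- by move=> /etaE[t [y []]].
Qed.

Lemma shift_tight : tight xi -> tight (shift_filter xi).
Proof.
move=> [_ xiT]; split; first exact: shift_efilter.
move=> e Z /etaE[t [y [Jy [x xix xy] ->]]] [Zfin Zle Zcov].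
have [x0 Jx] := efilter_idemP xiF xix.
have y0 : y != \bot by apply: contraNneq x0 => y0; rewrite -lex0 -y0.
pose f (e : triple) : triple := if e is Some (s, z, _)
  then triple_norm (a :: s) (z `&` theta_word (drop (size t) s) x) (a :: s)
  else None.
have /(_ _ (f @` Z) xix) [|e' [[e1 Ze1 <-] xie1]] := xiT; last first.
  exists e1; split=> //; apply/etaE.
  have [[e10|[s [z [z0 Jz e1E]]]] _] := Zle _ Ze1.
    by have [_ _ _ _ []] := xiF; move: xie1; rewrite e10.
  exists s, z; split=> //; rewrite e1E /= /triple_norm in xie1.
  move: xie1; case: ifP => [_|_] xie1; first by have [_ _ _ _ []] := xiF.
  by exists (z `&` theta_word (drop (size t) s) x) => //; exact: leIl.
split; first exact: finite_image.
- move=> _ [e1 Ze1 <-]; have [[->|[s [z [z0 Jz e1E]]]] e1le] := Zle _ Ze1.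
    by split; [left|].
  move: e1le; rewrite e1E => /(sle_idemP _ _ _ z0)[v sE zy] /=.
  rewrite sE drop_size_cat// /triple_norm; case: ifP => [_|/negbT n0].
    by split; [left|].
  split; last first.
    by apply/(sle_idemP _ _ _ n0); exists v => //; exact: leIr.
  right; exists (a :: t ++ v), (z `&` theta_word v x); split=> //.
  apply: is_ideal_le (ideal_word_ideal (a :: t ++ v)) _ (leIr _ _).
  exact: (@ideal_word_cat (a :: t) v).
- move=> e1 [->//|[s [x' [x'0 Jx' ->]]]] _ /(sle_idemP _ _ _ x'0)[v sE x'x].
  rewrite {s}sE in Jx' *.
  have [] := Zcov (idem (t ++ v) x').
  + right; exists (t ++ v), x'; split=> //; exact: (@ideal_word_behead a).
  + by [].
  + apply/(sle_idemP _ _ _ x'0); exists v => //; apply: le_trans x'x _.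
    exact: theta_word_le.
  move=> e2 Ze2 e20; exists (f e2); first by exists e2.
  have [[e2E|[s [z [z0 Jz e2E]]]] e2le] := Zle _ Ze2.
    by move: e20; rewrite e2E.
  move: e2le e20; rewrite e2E => /(sle_idemP _ _ _ z0)[v2 sE zy].
  rewrite {s e2E Jz}sE [f _]/= drop_size_cat// => e20.
  have [[u uE]|[u uE]] := smul_idem_neq0 e20.
  + have {uE} uE : v2 = v ++ u.
      by move: uE; rewrite -catA => /eqP; rewrite eqseq_cat// eqxx => /eqP.
    have [uI _ _ u0] := theta_word_action u.
    move: e20; rewrite {}uE catA smul_idem_catr => e20.
    have e2n : theta_word u x' `&` z != \bot.
      by apply/eqP => e2n; apply: e20; rewrite /triple_norm e2n eqxx.
    have ux : theta_word u x' `&` z <= z `&` theta_word (v ++ u) x.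
      by rewrite lexI leIr/= theta_word_cat; apply: le_trans (leIl _ _) _; exact: theta_word_le.
    have zn : z `&` theta_word (v ++ u) x != \bot.
      by apply: contraNneq e2n => zn; rewrite -lex0 -zn.
    rewrite triple_norm_idem// -/(idem _ _) -cat_cons smul_idem_catr.
    rewrite triple_norm_idem//; apply: contraNneq e2n => e2n.
    by rewrite -lex0 -e2n lexI leIl.
  + have {uE} uE : v = v2 ++ u.
      by move: uE; rewrite -catA => /eqP; rewrite eqseq_cat// eqxx => /eqP.
    have [uI _ _ u0] := theta_word_action u.
    move: e20; rewrite {}uE catA smul_idem_catl in x'x * => e20.
    have e2n : x' `&` theta_word u z != \bot.
      by apply/eqP => e2n; apply: e20; rewrite /triple_norm e2n eqxx.
    have xz : x' `&` theta_word u z <= theta_word u (z `&` theta_word v2 x).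
      by rewrite uI lexI leIr -theta_word_cat; apply: le_trans (leIl _ _) _.
    have zn : z `&` theta_word v2 x != \bot.
      by apply: contraNneq e2n => zn; rewrite -lex0 -u0 -zn.
    rewrite triple_norm_idem// -/(idem _ _) catA -cat_cons smul_idem_catl.
    rewrite triple_norm_idem//; apply: contraNneq e2n => e2n.
    by rewrite -lex0 -e2n lexI leIl.
Qed.

Lemma shift_assoc_word : assoc_word (shift_filter xi) w.
Proof.
have eta_ex t x : xi (idem (a :: t) x) -> shift_filter xi (idem t x).
  move=> xix; apply/etaE; exists t, x; split=> //; last by exists x.
  by apply: (@ideal_word_behead a); have [] := efilter_idemP xiF xix.
have ex_eta t y : shift_filter xi (idem t y) -> exists x, xi (idem (a :: t) x).
  by move=> /etaE[s [z [_ [x xix _] [ts _]]]]; exists x; rewrite ts.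
move: (xiw); case: w => [s|f] /=.
  move=> [[x xix] smax]; split; first by exists x; exact: eta_ex.
  by move=> t y /ex_eta[z xiz]; exact: smax xiz.
move=> [h1 h2]; split.
- move=> n; have [[|b t] [x [xix //nt]]] := h1 n.+1.
  exists t, x; split=> //; apply: eta_ex.
  by have := h2 _ _ xix; rewrite /mkseq /= => -[<- _].
- move=> t y /ex_eta[z xiz].
  have [_] := assoc_word_take xiF (conj h1 h2 : assoc_word xi (word_cons a (Inf f))) xiz.
  by rewrite word_take_cons => -[].
Qed.

Lemma shift_slice n : word_size_ge n w ->
  slice (shift_filter xi) w n =
  [set y | ideal_word (word_take n w) y /\
           exists2 x, slice xi (word_cons a w) n.+1 x & x <= y].
Proof.
move=> nw; apply/seteqP; split=> y /=.
- move=> [Jy /etaE[t [z [Jz [x xix xz] [tE yz _]]]]]; split=> //.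
  exists x; last by rewrite yz.
  rewrite -{t Jz}tE in xix.
  rewrite /slice /= word_take_cons; split=> //.
  by have [] := efilter_idemP xiF xix.
- move=> [Jy [x [Jx xix] xy]]; split=> //.
  apply/etaE; exists (word_take n w), y; split=> //; exists x => //.
  by rewrite word_take_cons in xix.
Qed.

End Shift.

Lemma tight_spectrum_shift (xi : tight_spectrum1) :
  shift_filter (val (val xi)) \in tight.
Proof.
rewrite inE; have xiT := set_valP (val xi).
have [v xiv /word_consP[a [w vE]]] := set_valP xi; rewrite vE in xiv.
by apply: shift_tight xiv _ => //; have [] := xiT.
Qed.

Definition sigma (xi : tight_spectrum1) : tight_spectrum :=
  exist (fun eta => eta \in tight) _ (tight_spectrum_shift xi).

Section Ultrafilters.
Variables (J : set B) (F : set B).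
Hypothesis JI : is_ideal J.

Lemma poset_filterI x y :
  poset_filter J <=%O \bot F -> F x -> F y -> F (x `&` y).
Proof.
move=> [FJ _ Fle Fd _] Fx Fy; have [z [Fz zx zy]] := Fd _ _ Fx Fy.
apply: Fle Fz _ _; last by rewrite lexI zx zy.
by have [_ _ h] := JI; apply/h/FJ.
Qed.

Lemma poset_ultrafilter_disjoint x : poset_ultrafilter J <=%O \bot F ->
  J x -> ~ F x -> exists2 y, F y & x `&` y = \bot.
Proof.
move=> [FF Fmax] Jx nFx; apply: contrapT => nex.
have [FJ [y0 Fy0] Fle _ _] := FF.
apply: nFx; rewrite -(Fmax [set z | J z /\ exists2 y, F y & x `&` y <= z]).
- by split=> //; exists y0 => //; exact: leIl.
- split.
  + by move=> z [].
  + by exists x; split=> //; exists y0 => //; exact: leIl.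
  + move=> z z' [Jz [y Fy yz]] Jz' zz'; split=> //; exists y => //.
    exact: le_trans zz'.
  + move=> z z' [Jz [y Fy yz]] [Jz' [y' Fy' yz']]; exists (z `&` z').
    split; [split|exact: leIl|exact: leIr].
      by have [_ _ h] := JI; exact: h.
    exists (y `&` y'); first exact: poset_filterI.
    rewrite lexI; apply/andP; split.
      by apply: le_trans yz; rewrite leI2 ?leIl.
    by apply: le_trans yz'; rewrite leI2 ?leIr.
  + move=> [_ [y Fy]]; rewrite lex0 => /eqP xy; apply: nex.
    by exists y.
- by move=> z Fz; split; [exact: FJ|exists z => //; exact: leIr].
Qed.

Lemma disjoint_poset_ultrafilter : poset_filter J <=%O \bot F ->
  (forall x, J x -> ~ F x -> exists2 y, F y & x `&` y = \bot) ->
  poset_ultrafilter J <=%O \bot F.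
Proof.
move=> FF h; split=> // F' [F'J _ _ F'd F'0] FF'.
apply/seteqP; split=> // x F'x; apply: contrapT => nFx.
have [y Fy xy] := h _ (F'J _ F'x) nFx.
have [z [F'z zx zy]] := F'd _ _ F'x (FF' _ Fy).
have : z <= x `&` y by rewrite lexI zx zy.
by rewrite xy lex0 => /eqP z0; rewrite z0 in F'z.
Qed.

Lemma poset_ultrafilterU x y : poset_ultrafilter J <=%O \bot F ->
  J x -> J y -> F (x `|` y) -> F x \/ F y.
Proof.
move=> FU Jx Jy Fxy; apply: contrapT => /not_orP[nFx nFy].
have [x' Fx' x0] := poset_ultrafilter_disjoint FU Jx nFx.
have [y' Fy' y0] := poset_ultrafilter_disjoint FU Jy nFy.
have [FF _] := FU; have [_ _ _ _ []] := FF.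
have := poset_filterI FF Fxy (poset_filterI FF Fx' Fy').
by rewrite meetUl meetA x0 meet0x join0x [x' `&` _]meetC meetA y0 meet0x.
Qed.

End Ultrafilters.

Definition ultra (s : seq L) : set (set B) :=
  poset_ultrafilter (ideal_word s) <=%O \bot.

Definition uspace (s : seq L) : Type := set_type (ultra s).

HB.instance Definition _ s := Choice.on (uspace s).

Section UspaceTopology.
Variable s : seq L.

Definition ubase (x : B) : set (uspace s) := [set F | val F x].

Lemma ubase_cover : \bigcup_(U in ubase @` ideal_word s) U = setT.
Proof.
apply/seteqP; split=> // F _; have [[FJ [x Fx] _ _ _] _] := set_valP F.
by exists (ubase x) => //; exists x => //; exact: FJ.
Qed.

Lemma ubase_join U V F :
  (ubase @` ideal_word s) U -> (ubase @` ideal_word s) V -> U F -> V F ->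
  exists W, [/\ (ubase @` ideal_word s) W, W F & W `<=` U `&` V].
Proof.
move=> [x Jx <-] [y Jy <-] Fx Fy.
have JI := ideal_word_ideal s; have [_ _ hI] := JI.
exists (ubase (x `&` y)); split; first by exists (x `&` y) => //; exact: hI.
- by apply: (poset_filterI JI) Fx Fy; have [] := set_valP F.
- move=> F' Fxy; have [[_ _ Fle _ _] _] := set_valP F'.
  by split; apply: Fle Fxy _ _ => //; [exact: leIl|exact: leIr].
Qed.

HB.instance Definition _ := @isBaseTopological.Build (uspace s)
  (set (uspace s)) (ubase @` ideal_word s) idfun ubase_cover ubase_join.

End UspaceTopology.

Definition E0 : topologicalType := uspace [::].

Definition unital : Prop := exists t : B, forall x, x <= t.

(* [None] is the point $\emptyset$. *)
Definition F0 : Type := option E0.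

HB.instance Definition _ := Choice.on F0.

Definition F0_open (U : set F0) : Prop :=
  if `[< unital >] then open (Some @^-1` U)
  else @open (one_point_compactification E0) U.

Lemma F0_openT : F0_open setT.
Proof. by rewrite /F0_open; case: ifP => _; exact: openT. Qed.

Lemma F0_openI : setI_closed F0_open.
Proof.
by move=> U V; rewrite /F0_open; case: ifP => _; exact: openI.
Qed.

Lemma F0_open_bigU (I : Type) (f : I -> set F0) :
  (forall i, F0_open (f i)) -> F0_open (\bigcup_i f i).
Proof.
rewrite /F0_open; case: ifP => _ fo; last exact: bigcup_open.
by rewrite preimage_bigcup; exact: bigcup_open.
Qed.

HB.instance Definition _ :=
  isOpenTopological.Build F0 F0_openT F0_openI F0_open_bigU.

Definition E1 : topologicalType := {a : L & uspace [:: a]}.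

Definition dset (e : E1) : set B :=
  [set y | exists2 x, val (projT2 e) x & x <= y].

Lemma dset_ultra e : dset e \in ultra [::].
Proof.
rewrite inE; case: e => a F; have /= [[FJ F0 Fle Fd Fb] Fmax] := set_valP F.
have JI := ideal_word_ideal [:: a].
split.
  split=> //=.
  - by have [x Fx] := F0; exists x, x.
  - by move=> x y [x' Fx xx'] _ xy; exists x' => //; apply: le_trans xy.
  - move=> x y [x' Fx xx'] [y' Fy yy']; have [z [Fz zx zy]] := Fd _ _ Fx Fy.
    exists z; split; first by exists z.
      exact: le_trans xx'.
    exact: le_trans yy'.
  - by move=> [x Fx]; rewrite lex0 => /eqP x0; apply: Fb; rewrite -x0.
move=> F' FF' sub; have [_ _ Fle' Fd' Fb'] := FF'.
have sF : val F `<=` F' by move=> x Fx; apply: sub; exists x.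
have FE : F' `&` ideal_word [:: a] = val F.
  apply: Fmax; last by move=> x Fx; split; [exact: sF|exact: FJ].
  split.
  - by move=> x [].
  - by have [x Fx] := F0; exists x; split; [exact: sF|exact: FJ].
  - by move=> x y [F'x Jx] Jy xy; split=> //; apply: Fle' xy.
  - move=> x y [F'x Jx] [F'y Jy]; have [z [F'z zx zy]] := Fd' _ _ F'x F'y.
    by exists z; split=> //; split=> //; exact: is_ideal_le Jx zx.
  - by move=> [].
apply/seteqP; split=> // x F'x; have [y Fy] := F0.
exists (x `&` y); last exact: leIl.
rewrite -FE; split.
  by apply: (poset_filterI (ideal_word_ideal [::]) FF') => //; exact: sF.
by apply: is_ideal_le (leIr _ _); [|exact: FJ].
Qed.

Definition dmap (e : E1) : E0 := exist _ (dset e) (dset_ultra e).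

Definition rset (e : E1) : set B :=
  [set x | val (projT2 e) (theta G (projT1 e) x)].

Lemma rset_ultra e : rset e = set0 \/ ultra [::] (rset e).
Proof.
have [|/set0P [x0 Fx0]] := eqVneq (rset e) set0; [by left|right].
case: e Fx0 => a F; rewrite /rset /= => Fx0.
have FU := set_valP F; have /= [FF _] := FU; have /= [FJ _ Fle Fd Fb] := FF.
have JI := ideal_word_ideal [:: a].
have [aI aU aD ab] := theta_action G a.
have Ja x : ideal_word [:: a] (theta G a x).
  by rewrite ideal_word1; apply: range_ideal; exists x.
apply: (@disjoint_poset_ultrafilter).
  split=> //=.
  - by exists x0.
  - by move=> x y Fx _ xy; apply: Fle Fx (Ja y) (@theta_word_le [:: a] _ _ xy).
  - move=> x y Fx Fy; exists (x `&` y); split; [|exact: leIl|exact: leIr].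
    by rewrite aI; exact: (poset_filterI JI).
  - by rewrite ab.
move=> x _ nFx; exists (x0 `\` x); last by rewrite diffKI.
rewrite /= aD.
suff [/nFx|] : val F (theta G a x) \/ val F (theta G a x0 `\` theta G a x) by [].
apply: (poset_ultrafilterU JI FU) => //.
- by rewrite -aD; exact: Ja.
- by rewrite diffKU; apply: Fle Fx0 _ _; rewrite ?leUr// -aU; exact: Ja.
Qed.

Definition rmap (e : E1) : F0 := insub (rset e).

Definition F0_sce : set F0 := ~` closure (range rmap).

Definition F0_fin : set F0 :=
  [set v | exists2 V, nbhs v V & compact (rmap @^-1` V)].

Definition F0_rg : set F0 := F0_fin `\` closure F0_sce.

Definition F0_sg : set F0 := ~` F0_rg.

Definition E0_sg : set E0 := [set v | F0_sg (Some v)].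

Definition composable (n : nat) : set {ptws 'I_n -> E1} :=
  [set mu | forall i j : 'I_n, j = i.+1 :> nat ->
     Some (dmap (mu i)) = rmap (mu j)].

(* The paths of length 1 are the one-term sequences of edges. *)
Definition En (n : nat) : topologicalType :=
  if n is 0 then E0 else set_type (@composable n).

Definition Estar : topologicalType := {n : nat & En n}.

Definition vertex (v : E0) : Estar := existT (fun n => En n) 0 v.

Definition path_of (n : nat) (mu : En n.+1) : Estar :=
  existT (fun n => En n) n.+1 mu.

Definition Einf : set (nat -> E1) :=
  [set e | forall i, Some (dmap (e i)) = rmap (e i.+1)].

Definition Estar_d (mu : Estar) : E0 :=
  match mu with
  | existT 0 v => v
  | existT n.+1 e => dmap (val (e : set_type (@composable n.+1)) ord_max)
  end.

Definition Estar_r (mu : Estar) : F0 :=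
  match mu with
  | existT 0 v => Some v
  | existT n.+1 e => rmap (val (e : set_type (@composable n.+1)) ord0)
  end.

(* The [i]-th edge (counting from 0), if [i] is less than the length. *)
Definition Estar_edge (mu : Estar) (i : nat) : option E1 :=
  match mu with
  | existT 0 _ => None
  | existT n.+1 e =>
      omap (val (e : set_type (@composable n.+1))) (insub i : option 'I_n.+1)
  end.

Definition boundary_finite : set Estar := [set mu | E0_sg (Estar_d mu)].

Definition boundary : Type := (set_type Einf + set_type boundary_finite)%type.

HB.instance Definition _ := Choice.on boundary.

Definition boundary_r (mu : boundary) : F0 :=
  match mu with
  | inl e => rmap (val e 0)
  | inr e => Estar_r (val e)
  end.

Definition boundary_edge (mu : boundary) (i : nat) : option E1 :=
  match mu with
  | inl e => Some (val e i)
  | inr e => Estar_edge (val e) i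
  end.

(* $\mathcal{Z}(Q)$; in the second case, [nu] is the beginning of length
   [n.+1] of [mu]. *)
Definition Zset (Q : set Estar) : set boundary :=
  [set mu | (exists2 v, boundary_r mu = Some v & Q (vertex v)) \/
    exists n (nu : En n.+1),
      (forall i : 'I_n.+1, boundary_edge mu i = Estar_edge (path_of nu) i) /\
      Q (path_of nu)].

HB.instance Definition _ := @isSubBaseTopological.Build boundary
  (set Estar * set Estar)%type
  [set UK | open UK.1 /\ compact UK.2]
  (fun UK => Zset UK.1 `&` ~` Zset UK.2).

Lemma composable_behead n (e : set_type (@composable n.+2)) :
  (fun i : 'I_n.+1 => val e (lift ord0 i)) \in @composable n.+1.
Proof.
rewrite inE => i j ij; apply: (set_valP e).
by rewrite /= /bump !leq0n !add1n ij.
Qed.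

(* Paths of length 0 are fixed, by convention: they are not in the domain of
   the shift. *)
Definition Estar_shift (mu : Estar) : Estar :=
  match mu with
  | existT 0 v => vertex v
  | existT 1 e => vertex (Estar_d (@path_of 0 e))
  | existT n.+2 e =>
      @path_of n (exist (fun nu => nu \in @composable n.+1) _
                    (composable_behead e))
  end.

Lemma Estar_shift_d mu : Estar_d (Estar_shift mu) = Estar_d mu.
Proof.
case: mu => -[//|[//|n]] e /=; congr (dmap (val e _)).
exact: val_inj.
Qed.

Lemma Einf_shift (e : set_type Einf) : (fun i => val e i.+1) \in Einf.
Proof. by rewrite inE => i; exact: (set_valP e). Qed.

Lemma boundary_finite_shift (mu : set_type boundary_finite) :
  Estar_shift (val mu) \in boundary_finite.
Proof. by rewrite inE /boundary_finite /= Estar_shift_d; exact: (set_valP mu). Qed.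

(* $E^0_{sg}$, as a subset of the boundary path space. *)
Definition boundary_vertices : set boundary :=
  [set mu | exists nu v, mu = inr nu /\ val nu = vertex v].

Definition boundary_positive : set boundary := ~` boundary_vertices.

Definition boundary_shift (mu : boundary_positive) : boundary :=
  match val mu with
  | inl e => inl (exist (fun nu => nu \in Einf) _ (Einf_shift e))
  | inr e => inr (exist (fun nu => nu \in boundary_finite) _
                       (boundary_finite_shift e))
  end.

End GBDS.

Arguments tight_spectrum1 {disp B L} G.
Arguments F0_sce {disp B L} G.
Arguments F0_fin {disp B L} G.
Arguments F0_rg {disp B L} G.
Arguments F0_sg {disp B L} G.
Arguments E0_sg {disp B L} G.
Arguments Einf {disp B L} G.
Arguments boundary_finite {disp B L} G.
Arguments boundary_vertices {disp B L} G.
Arguments boundary_positive {disp B L} G.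

Definition homeomorphism (X Y : topologicalType) (f : X -> Y) : Prop :=
  exists g : Y -> X, [/\ cancel f g, cancel g f, continuous f & continuous g].

(* Main.v *)
Require Import Defs.
From HB Require Import structures.
From mathcomp Require Import all_boot all_order.
From mathcomp Require Import zify finmap.
From mathcomp Require Import boolp classical_sets functions cardinality fsbigop topology.

(* A path [mu] of the correspondence, finite or infinite, is recorded by its range
   and its edges; for a word [s] labelling a beginning of [mu], the ultrafilter of
   B reached after [s] restricts to an ultrafilter in I_s. Together these form the
   filter {(s, x, s) | x in I_s belongs to the vertex of [mu] after s}, and [mu]
   can be recovered from it because a vertex determines all the earlier ones,
   through preimages under the actions. Conversely the slices of a tight filter
   are ultrafilters, so that tight filters come from paths, and a filter coming
   from a path that ends in a vertex v is tight exactly if every x in v is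
   singular: either infinitely many letters act on x nontrivially, or some nonzero
   y <= x is killed by all letters. Unwinding the topology of F^0, this says that
   v belongs to E^0_sg. Finally, the sets of paths labelled s whose last vertex
   contains x (x in I_s) form a base of compact open sets of E^*, hence the sets
   {xi | (s, x, s) in xi} and their complements generate both topologies. *)

Set Implicit Arguments.
Unset Strict Implicit.
Unset Printing Implicit Defensive.

Import Order.Theory.
Local Open Scope classical_set_scope.
Local Open Scope order_scope.

(** * Ultrafilters in ideals *)

Section BooleanUltrafilters.
Context {disp : Order.disp_t} {B : cbDistrLatticeType disp}.
Implicit Types (J K F : set B) (x y : B).

Lemma ultra_le J F x y :
  poset_ultrafilter J <=%O \bot F -> F x -> J y -> x <= y -> F y.
Proof. by move=> [[_ _ Fle _ _] _]; exact: Fle. Qed.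

Lemma ultra_neq0 J F x : poset_ultrafilter J <=%O \bot F -> F x -> x != \bot.
Proof. by move=> [[_ _ _ _ F0] _] Fx; apply/eqP => x0; rewrite x0 in Fx. Qed.

Lemma ultraI J F x y : is_ideal J ->
  poset_ultrafilter J <=%O \bot F -> F x -> F y -> F (x `&` y).
Proof. by move=> JI [FF _] Fx Fy; exact: (poset_filterI JI FF Fx Fy). Qed.

(** Primeness of [F] for the splitting of [x] into its meet with [y] and the difference. The algebra
    may lack a top, so complements are taken inside a member of [F]. *)
Lemma ultra_split J F x y : is_ideal J ->
  poset_ultrafilter J <=%O \bot F -> F x -> F (x `&` y) \/ F (x `\` y).
Proof.
move=> JI FU Fx; have [[FJ _ _ _ _] _] := FU.
apply: (poset_ultrafilterU JI FU); last by rewrite joinIB.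
- by apply: is_ideal_le JI (FJ _ Fx) _; exact: leIl.
- by apply: is_ideal_le JI (FJ _ Fx) _; exact: leBx.
Qed.

(** For [x] outside the upward closure, [ultra_split] puts the difference of [x0] and [x] into [F];
    a member disjoint from each non-member is what maximality amounts to. *)
Lemma ultra_up J K F : is_ideal J -> is_ideal K -> J `<=` K ->
  poset_ultrafilter J <=%O \bot F ->
  poset_ultrafilter K <=%O \bot [set y | K y /\ exists2 x, F x & x <= y].
Proof.
move=> JI KI JK FU; have [[FJ [x0 Fx0] _ _ Fb] _] := FU.
apply: (disjoint_poset_ultrafilter).
- split=> [x []||||[_ [x Fx]]] //.
  + by exists x0; split; [exact/JK/FJ|exists x0].
  + by move=> x y [Kx [z Fz zx]] Ky xy; split=> //; exists z => //; exact: le_trans xy.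
  + move=> x y [Kx [x' Fx' xx']] [Ky [y' Fy' yy']]; exists (x `&` y).
    split; [split|exact: leIl|exact: leIr].
      by apply: is_ideal_le KI Kx _; exact: leIl.
    by exists (x' `&` y'); [exact: (ultraI JI FU)|exact: leI2].
  + by rewrite lex0 => /eqP x0'; apply: Fb; rewrite -x0'.
- move=> x Kx nFx; exists (x0 `\` x); last exact: diffKI.
  have [Fxx|Fd] := ultra_split x JI FU Fx0.
    by case: nFx; split=> //; exists (x0 `&` x) => //; exact: leIr.
  split; last by exists (x0 `\` x).
  exact/JK/FJ.
Qed.

(** A common element [x0] of [F] and [J] replaces a top: differences taken inside [x0] stay in
    [J]. *)
Lemma ultra_restr J K F : is_ideal J -> is_ideal K -> J `<=` K ->
  poset_ultrafilter K <=%O \bot F -> (exists2 x, F x & J x) ->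
  poset_ultrafilter J <=%O \bot (F `&` J).
Proof.
move=> JI KI JK FU [x0 Fx0 Jx0]; have [[FK _ _ _ Fb] _] := FU.
apply: (disjoint_poset_ultrafilter).
- split=> [x []||||[]] //.
  + by exists x0.
  + by move=> x y [Fx Jx] Jy xy; split=> //; apply: (ultra_le FU Fx) => //; exact: JK.
  + move=> x y [Fx Jx] [Fy Jy]; exists (x `&` y).
    split; [split|exact: leIl|exact: leIr].
      exact: (ultraI KI FU).
    by apply: is_ideal_le JI Jx _; exact: leIl.
- move=> x Jx nFx; exists (x0 `\` x); last exact: diffKI.
  have [Fxx|Fd] := ultra_split x KI FU Fx0.
    case: nFx; split=> //; apply: (ultra_le FU Fxx); last exact: leIr.
    exact: JK.
  by split=> //; apply: is_ideal_le JI Jx0 _; exact: leBx.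
Qed.

Lemma ultra_eq J F F' : poset_ultrafilter J <=%O \bot F ->
  poset_ultrafilter J <=%O \bot F' -> F `<=` F' -> F = F'.
Proof. by move=> [_ Fmax] [F'F _] FF'; rewrite (Fmax _ F'F FF'). Qed.

Lemma ultra_exists J x : is_ideal J -> J x -> x != \bot ->
  exists2 F, poset_ultrafilter J <=%O \bot F & F x.
Proof.
move=> JI Jx x0.
(* [P] admits the empty set because Zorn also asks for the union of the empty chain; the principal
   filter in [upP] later shows that the maximal set is not empty. *)
pose P (F : set B) := F = set0 \/ (poset_filter J <=%O \bot F /\ F x).
have [FF FFP tot|F [PF Fmax]] := @Zorn_bigcup _ P.
  have [ne|/forallNP all0] := pselect (exists X, FF X /\ X !=set0); last first.
    left; apply/seteqP; split=> // z [X FX Xz].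
    by apply: (all0 X); split=> //; exists z.
  have [X [FX [z Xz]]] := ne; right.
  have good Y y : FF Y -> Y y -> poset_filter J <=%O \bot Y /\ Y x.
    by move=> FY Yy; have [Y0|//] := FFP _ FY; rewrite Y0 in Yy.
  split; last by exists X => //; have [] := good _ _ FX Xz.
  split=> [y [Y FY Yy]||||[Y FY Y0]].
  - by have [[YJ _ _ _ _] _] := good _ _ FY Yy; exact: YJ.
  - by exists z, X.
  - move=> y y' [Y FY Yy] Jy' yy'; exists Y => //.
    by have [[_ _ Yle _ _] _] := good _ _ FY Yy; exact: Yle yy'.
  - move=> y y' [Y FY Yy] [Y' FY' Y'y'].
    have [Z FZ [Zy Zy']] : exists2 Z, FF Z & Z y /\ Z y'.
      by have [YY'|Y'Y] := tot _ _ FY FY'; [exists Y' => //|exists Y => //];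
        split=> //; [exact: YY'|exact: Y'Y].
    have [[_ _ _ Zd _] _] := good _ _ FZ Zy.
    by have [u [Zu uy uy']] := Zd _ _ Zy Zy'; exists u; split=> //; exists Z.
  - by have [[_ _ _ _ YB] _] := good _ _ FY Y0.
have upP : P [set y | J y /\ x <= y].
  right; split; last by [].
  split=> [y []||||[_]] //.
  - by exists x.
  - by move=> y z [Jy xy] Jz yz; split=> //; exact: le_trans yz.
  - move=> y z [Jy xy] [Jz xz]; exists x; split=> //.
  - by rewrite lex0 => /eqP x0'; rewrite x0' eqxx in x0.
have [F0|[FF Fx]] := PF.
  by case: (Fmax _ _ upP); split=> [|/(_ x)]; rewrite F0 => // /(_ (conj Jx (lexx x))).
exists F => //; split=> // F' F'F FF'; apply/seteqP; split=> //.
apply: contrapT => nF'F; apply: (Fmax F'); first by split.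
by right; split=> //; exact: FF'.
Qed.

End BooleanUltrafilters.

(** * Paths and their vertices *)

Section Paths.
Context {disp : Order.disp_t} {B : cbDistrLatticeType disp} {L : choiceType}.
Variable G : gbds B L.
Implicit Types (r : F0 G) (E : nat -> option (E1 G)) (s t : seq L) (x y : B).

Lemma theta_ideal a x : ideal G a (theta G a x).
Proof. by apply: range_ideal; exists x. Qed.

Lemma theta_wordI s x y :
  theta_word G s (x `&` y) = theta_word G s x `&` theta_word G s y.
Proof. by have [] := theta_word_action G s. Qed.

Lemma theta_wordB s x y :
  theta_word G s (x `\` y) = theta_word G s x `\` theta_word G s y.
Proof. by have [] := theta_word_action G s. Qed.

Lemma theta_word0 s : theta_word G s \bot = \bot.
Proof. by have [] := theta_word_action G s. Qed.

Lemma theta_word_neq0 s x : theta_word G s x != \bot -> x != \bot.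
Proof. by apply: contraNneq => ->; rewrite theta_word0. Qed.

Lemma ideal_word_le s x y : ideal_word G s x -> y <= x -> ideal_word G s y.
Proof. exact: is_ideal_le (ideal_word_ideal G s). Qed.

(** Closing the ultrafilter of an edge upwards adds nothing inside its ideal, so an edge can be
    handled through its vertex [dset e]. *)
Lemma dsetE (e : E1 G) x :
  ideal G (projT1 e) x -> dset e x <-> val (projT2 e) x.
Proof.
case: e => a F /=; rewrite -ideal_word1 => Jx; split; last by exists x.
by have FU := set_valP F; move=> [y Fy yx]; apply: (ultra_le FU Fy).
Qed.

Lemma edge_eq (e e' : E1 G) : projT1 e = projT1 e' ->
  (forall x, dset e x -> dset e' x) -> e = e'.
Proof.
case: e e' => [a F] [b F'] /= ab; subst b => ee'; congr existT; apply: val_inj.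
apply: ultra_eq (set_valP F) (set_valP F') _ => z Fz.
have [[FJ _ _ _ _] _] := set_valP F.
have Jz : ideal G a z by rewrite -ideal_word1; exact: FJ.
by apply/(@dsetE (existT _ a F')) => //; apply/ee'; exists z.
Qed.

(** The existential covers the edges whose range is the point at infinity: [rset e] is then empty
    and both sides fail. *)
Lemma rmap_dset (e : E1 G) x :
  (exists2 v, rmap e = Some v & val v x) <-> dset e (theta G (projT1 e) x).
Proof.
rewrite dsetE; last exact: theta_ideal.
rewrite /rmap; case: insubP => [v _ ve|/negP nu].
  split=> [[v' [<-]]|h]; first by rewrite ve.
  by exists v => //; rewrite ve.
split=> [[v]//|h]; case: nu; rewrite inE; have [e0|//] := rset_ultra e.
by have : rset e x by []; rewrite e0.
Qed.

(* A path is given by its range [r] and the sequence [E] of its edges, which is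
   eventually [None] if the path is finite. *)
Definition pathlike r E :=
  [/\ E 0 = None -> r <> None, forall e, E 0 = Some e -> rmap e = r &
    forall i e, E i.+1 = Some e -> exists2 e', E i = Some e' & rmap e = Some (dmap e')].

Definition tail E : nat -> option (E1 G) := fun i => E i.+1.

Lemma pathlike_tail r E e : pathlike r E -> E 0 = Some e ->
  pathlike (Some (dmap e)) (tail E).
Proof.
move=> [_ _ Es] E0e; split=> [//|e' /Es[e'']|i e' /Es[e'']].
- by rewrite E0e => -[<-].
- by move=> ? ?; exists e''.
Qed.

(* The word [s] labels a beginning of the path, and [x] belongs to the vertex
   that this beginning leads to. *)
Fixpoint pmem r E s x : Prop :=
  if s is a :: s' then
    exists e, [/\ E 0 = Some e, projT1 e = a & pmem (Some (dmap e)) (tail E) s' x]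
  else exists2 v, r = Some v & val v x.

Lemma pmem_le r E s x y : pmem r E s x -> x <= y -> pmem r E s y.
Proof.
elim: s r E => [|a s IH] r E /=.
  move=> [v -> vx] xy; exists v => //.
  exact: ultra_le (set_valP v) vx _ xy.
by move=> [e [E0 ea ex]] xy; exists e; split=> //; exact: IH xy.
Qed.

Lemma pmem_neq0 r E s x : pmem r E s x -> x != \bot.
Proof.
elim: s r E => [|a s IH] r E /=.
  by move=> [v _]; exact: ultra_neq0 (set_valP v).
by move=> [e [_ _]]; exact: IH.
Qed.

Lemma pmemI r E s x y : pmem r E s x -> pmem r E s y -> pmem r E s (x `&` y).
Proof.
elim: s r E => [|a s IH] r E /=.
  move=> [v -> vx] [w [<-] vy]; exists v => //.
  exact: ultraI (ideal_word_ideal G [::]) (set_valP v) vx vy.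
move=> [e [E0 ea ex]] [e' []]; rewrite E0 => -[<-] _ ey.
by exists e; split=> //; exact: IH.
Qed.

Lemma pmem_split r E s x y : pmem r E s x ->
  pmem r E s (x `&` y) \/ pmem r E s (x `\` y).
Proof.
elim: s r E => [|a s IH] r E /=.
  move=> [v -> vx].
  by have [] := ultra_split y (ideal_word_ideal G [::]) (set_valP v) vx;
    [left|right]; exists v.
move=> [e [E0 ea ex]].
by have [h|h] := IH _ _ ex; [left|right]; exists e.
Qed.

(** Going back along an edge with letter [a] takes the preimage of its vertex under [theta G a], by
    [rmap_dset]; this is iterated over [t]. *)
Lemma pmem_theta r E s t x : pathlike r E ->
  pmem r E (s ++ t) (theta_word G t x) -> pmem r E s x.
Proof.
elim: s r E => [|a s IH] r E rE /=; last first.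
  move=> [e [E0 ea ex]]; exists e; split=> //.
  exact: IH (pathlike_tail rE E0) ex.
elim: t r E x rE => [//|a t IH] r E x rE /= [e [E0 ea]].
move=> /(IH _ _ _ (pathlike_tail rE E0))[v [<-]].
rewrite /= -ea -rmap_dset.
by have [_ /(_ _ E0) -> _] := rE.
Qed.

(** Converse of [pmem_theta]; the element [y] only certifies that the path continues with the
    letters of [t]. *)
Lemma theta_pmem r E s t x y : pathlike r E ->
  pmem r E s x -> pmem r E (s ++ t) y -> pmem r E (s ++ t) (theta_word G t x).
Proof.
elim: s r E => [|a s IH] r E rE /=; last first.
  move=> [e [E0 ea ex]] [e' []]; rewrite E0 => -[<-] _ ey.
  exists e; split=> //; exact: IH (pathlike_tail rE E0) ex ey.
elim: t r E x rE => [//|a t IH] r E x rE rx /= [e [E0 ea ey]].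
exists e; split=> //; apply: IH => //; first exact: pathlike_tail rE E0.
exists (dmap e) => //=; rewrite -ea -rmap_dset.
by have [_ /(_ _ E0) -> _] := rE.
Qed.

Lemma pmem_comparable r E s t x y : pmem r E s x -> pmem r E t y ->
  (size s <= size t)%N -> exists u, t = s ++ u.
Proof.
elim: s t r E => [|a s IH] [|b t] r E //= ; first by exists [::].
  by exists (b :: t).
move=> [e [E0 <- ex]] [e' []]; rewrite E0 => -[<-] <- ey.
by rewrite ltnS => /(IH _ _ _ ex ey)[u ->]; exists u.
Qed.

(** The first edge is an ultrafilter in the ideal of [a]. The image under [s] of one of its elements
    lies in the vertex and in the ideal of the word, and can be met with [x]. *)
Lemma pmem_ideal r E a s x : pathlike r E -> pmem r E (a :: s) x ->
  exists y, [/\ ideal_word G (a :: s) y, y <= x & pmem r E (a :: s) y].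
Proof.
move=> rE rx; have [e [E0 ea _]] := rx.
have [[FJ [z Fz] _ _ _] _] := set_valP (projT2 e).
have Jz := FJ _ Fz; have rz : pmem r E [:: a] z.
  by exists e; split=> //; exists (dmap e) => //; exists z.
exists (theta_word G s z `&` x); split.
- rewrite ea in Jz; apply: (ideal_word_le (ideal_word_cat s Jz)); exact: leIl.
- exact: leIr.
- apply: pmemI => //; exact: (@theta_pmem r E [:: a] s z x).
Qed.

Lemma pmem_ideal_le r E s x : pathlike r E -> pmem r E s x ->
  exists y, [/\ ideal_word G s y, y <= x & pmem r E s y].
Proof.
by case: s => [|a s]; [exists x|exact: pmem_ideal].
Qed.

Lemma pmem_inj r E r' E' s x : pathlike r E -> pathlike r' E' ->
  pmem r E s x ->
  (forall y, ideal_word G s y -> pmem r E s y <-> pmem r' E' s y) ->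
  r = r' /\ forall i, (i < size s)%N -> E i = E' i.
Proof.
move=> rE rE' rx h.
(* A vertex is the upward closure of its part in the ideal, so the agreement extends to all of B;
   the induction needs this form because the ideal changes with the word. *)
have {}h y : pmem r E s y <-> pmem r' E' s y.
  split=> [/(pmem_ideal_le rE)|/(pmem_ideal_le rE')].
    by move=> [z [Jz zy /(h _ Jz)]] /pmem_le; exact.
  by move=> [z [Jz zy /(h _ Jz)]] /pmem_le; exact.
elim: s r E r' E' rE rE' rx h => [|a s IH] r E r' E' rE rE' /=.
  move=> [v -> vx] h; split=> //.
  have [v' r'v' _] : exists2 v', r' = Some v' & val v' x by apply/h; exists v.
  rewrite r'v'; congr Some; apply: val_inj; apply: ultra_eq (set_valP v) (set_valP v') _.
  move=> y vy; have [w] : exists2 w, r' = Some w & val w y by apply/h; exists v.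
  by rewrite r'v' => -[<-].
move=> rx h; have [e [E0 ea ex]] := rx.
have r'x : pmem r' E' (a :: s) x by exact/h.
have [e' [E'0 e'a e'x]] := r'x.
(* An element of the first vertex is moved forward along [s], compared at the end of the word, and
   moved back along the other path. *)
have ee' : e = e'.
  have eE z : dset e z -> dset e' z.
    have rz : dset e z <-> pmem r E [:: a] z.
      split; first by exists e; split=> //; exists (dmap e).
      by move=> [e1 []]; rewrite E0 => -[<-] _ [v [<-]].
    have r'z : dset e' z <-> pmem r' E' [:: a] z.
      split; first by exists e'; split=> //; exists (dmap e').
      by move=> [e1 []]; rewrite E'0 => -[<-] _ [v [<-]].
    rewrite rz r'z => hz; apply: (@pmem_theta r' E' [:: a] s) => //.
    by apply/h; exact: (@theta_pmem r E [:: a] s z x).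
  by apply: edge_eq eE; rewrite ea e'a.
subst e'; split.
  by have [_ /(_ _ E0) <- _] := rE; have [_ /(_ _ E'0) <- _] := rE'.
have [] := IH _ _ _ _ (pathlike_tail rE E0) (pathlike_tail rE' E'0) ex _.
  move=> y; split=> hy.
    have : pmem r E (a :: s) y by exists e.
    by move/h => /= [e1 []]; rewrite E'0 => -[<-].
  have : pmem r' E' (a :: s) y by exists e.
  by move/h => /= [e1 []]; rewrite E0 => -[<-].
by move=> _ h' [|i] /=; [rewrite E0 E'0|rewrite ltnS => /h'].
Qed.

Lemma pathlike_root r E : pathlike r E -> E 0 = None -> exists x, pmem r E [::] x.
Proof.
move=> [h _ _] /h; case: r {h} => // v _.
have [[_ [x vx] _ _ _] _] := set_valP v; by exists x, v.
Qed.

Lemma pathlike_edge r E i e : pathlike r E -> E i = Some e ->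
  exists s x, size s = i.+1 /\ pmem r E s x.
Proof.
elim: i r E e => [|i IH] r E e rE Ei.
  have [[_ [x Fx] _ _ _] _] := set_valP (projT2 e).
  exists [:: projT1 e], x; split=> //=; exists e; split=> //.
  by exists (dmap e) => //; exists x.
have [e0 E0] : exists e0, E 0 = Some e0.
  move: {IH} e Ei; elim: i => [|i IH] e Ei.
    by have [_ _ /(_ _ _ Ei)[e' ->]] := rE; exists e'.
  by have [_ _ /(_ _ _ Ei)[e' /IH]] := rE.
have [s [x [si sx]]] := IH _ _ _ (pathlike_tail rE E0) Ei.
by exists (projT1 e0 :: s), x; split; [rewrite /= si|exists e0].
Qed.

Lemma pmem_edge r E s x i : pmem r E s x -> (i < size s)%N -> exists e, E i = Some e.
Proof.
elim: s r E i => [//|a s IH] r E [|i] /= [e [E0 _ ex]]; first by exists e.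
by rewrite ltnS; exact: IH ex.
Qed.

Lemma pmem_ext r E E' s x : (forall i, (i < size s)%N -> E i = E' i) ->
  pmem r E s x <-> pmem r E' s x.
Proof.
elim: s r E E' => [//|a s IH] r E E' h /=.
rewrite (h 0%N)//; have {}h e := IH e (tail E) (tail E') (fun i => h i.+1).
by split=> -[e [E0 ea ex]]; exists e; split=> //; exact/h.
Qed.

(** The range and every edge occur in some labelled beginning, to which [pmem_inj] applies. *)
Lemma pathlike_inj r E r' E' : pathlike r E -> pathlike r' E' ->
  (forall s x, ideal_word G s x -> pmem r E s x <-> pmem r' E' s x) ->
  r = r' /\ E = E'.
Proof.
move=> rE rE' h.
suff [hr hE] : r = r' /\ forall i e, (E i = Some e <-> E' i = Some e).
  split=> //; apply/funext => i; case Ei : (E i) => [e|]; first by rewrite ((hE _ _).1 Ei).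
  by case E'i : (E' i) => [e|//]; rewrite ((hE _ _).2 E'i) in Ei.
split.
  case E0 : (E 0) => [e|].
    have [s [x [_ sx]]] := pathlike_edge rE E0.
    by have [] := pmem_inj rE rE' sx (h s).
  have [x sx] := pathlike_root rE E0.
  by have [] := pmem_inj rE rE' sx (h [::]).
move=> i e; split=> Ei.
  have [s [x [si sx]]] := pathlike_edge rE Ei.
  by have [_ <-] := pmem_inj rE rE' sx (h s); rewrite ?si.
have [s [x [si sx]]] := pathlike_edge rE' Ei.
have [_ <-] := pmem_inj rE' rE sx (fun y Jy => iff_sym (h s y Jy)) => //.
by rewrite si.
Qed.

End Paths.

(** * Tight filters *)

Section TightFilters.
Context {disp : Order.disp_t} {B : cbDistrLatticeType disp} {L : choiceType}.
Variable G : gbds B L.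
Implicit Types (r : F0 G) (E : nat -> option (E1 G)) (s t : seq L) (x y : B).
Implicit Types (xi : set (@triple disp B L)).

(** * The filter of a path and its tightness *)

Lemma smul_catr_neq0 s t x y : theta_word G t x `&` y != \bot ->
  smul G (idem s x) (idem (s ++ t) y) <> None.
Proof. by move=> h; rewrite smul_idem_catr triple_norm_idem. Qed.

Lemma smul_catl_neq0 s t x y : y `&` theta_word G t x != \bot ->
  smul G (idem (s ++ t) y) (idem s x) <> None.
Proof. by move=> h; rewrite smul_idem_catl triple_norm_idem. Qed.

Lemma smul_neq0 s t x y : smul G (idem s x) (idem t y) <> None ->
  (exists2 u, t = s ++ u & theta_word G u x `&` y != \bot) \/
  (exists2 u, s = t ++ u & x `&` theta_word G u y != \bot).
Proof.
move=> h; have [[u tu]|[u su]] := smul_idem_neq0 h; [left|right]; exists u => //.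
  by move: h; rewrite tu smul_idem_catr /triple_norm; case: eqP.
by move: h; rewrite su smul_idem_catl /triple_norm; case: eqP.
Qed.

Definition pathlike_filter r E : set (@triple disp B L) :=
  [set e | exists s x, [/\ e = idem s x, ideal_word G s x & pmem r E s x]].

Lemma pathlike_filter_idem r E s x :
  pathlike_filter r E (idem s x) <-> ideal_word G s x /\ pmem r E s x.
Proof.
split=> [[t [y [[-> -> _] Jy ty]]]//|[Jx sx]].
by exists s, x.
Qed.

Lemma pathlike_filter_le r E s t x y : pathlike r E ->
  pmem r E s x -> pmem r E (s ++ t) y ->
  exists2 z, pathlike_filter r E (idem (s ++ t) z) &
    sle G (idem (s ++ t) z) (idem s x) /\ sle G (idem (s ++ t) z) (idem (s ++ t) y).
Proof.
move=> rE sx ty.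
have := pmemI (theta_pmem rE sx ty) ty => /(pmem_ideal_le rE)[z [Jz zxy tz]].
have z0 := pmem_neq0 tz.
exists z; first exact/pathlike_filter_idem.
split; apply/(sle_idemP _ _ _ _ z0).
  by exists t => //; apply: le_trans zxy (leIl _ _).
by exists [::]; [rewrite cats0|apply: le_trans zxy (leIr _ _)].
Qed.

(** Upward closure is [pmem_theta]. For directedness, two words labelling beginnings of one path are
    comparable, and [pathlike_filter_le] gives a lower bound at the longer one. *)
Lemma path_efilter r E : pathlike r E -> efilter G (pathlike_filter r E).
Proof.
move=> rE; split.
- by move=> _ [s [x [-> Jx sx]]]; right; exists s, x; split=> //; exact: pmem_neq0 sx.
- case E0 : (E 0) => [e|].
    have [s [x [_ /(pmem_ideal_le rE)[y [Jy _ sy]]]]] := pathlike_edge rE E0.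
    by exists (idem s y); exact/pathlike_filter_idem.
  have [x rx] := pathlike_root rE E0.
  by exists (idem [::] x); exact/pathlike_filter_idem.
- move=> _ f [s [x [-> Jx sx]]] [->|[t [y [y0 Jy ->]]]]; first by rewrite /sle.
  move=> /(sle_idemP _ _ _ _ (pmem_neq0 sx))[u su xy].
  apply/pathlike_filter_idem; split=> //; apply: (@pmem_theta _ _ _ _ r E t u) => //.
  by rewrite -su; exact: pmem_le sx xy.
- move=> _ _ [s [x [-> Jx sx]]] [t [y [-> Jy ty]]].
  have [|/ltnW] := leqP (size s) (size t).
    move=> /(pmem_comparable sx ty)[u tu]; rewrite tu in ty *.
    by have [z ? [? ?]] := pathlike_filter_le rE sx ty; exists (idem (s ++ u) z).
  move=> /(pmem_comparable ty sx)[u su]; rewrite su in sx *.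
  by have [z ? [? ?]] := pathlike_filter_le rE ty sx; exists (idem (t ++ u) z).
- by move=> [s [x []]].
Qed.

(** The negation says that finitely many letters act nontrivially on [x] and that each nonzero part
    of [x] survives some letter: these are the regular sets of the dynamical system. *)
Definition singular x : Prop :=
  infinite_set [set a | theta G a x != \bot] \/
  exists y, [/\ y != \bot, y <= x & forall a, theta G a y = \bot].

Lemma singular_le x y : singular x -> x <= y -> singular y.
Proof.
move=> [inf|[z [z0 zx zs]]] xy; last first.
  by right; exists z; split=> //; exact: le_trans xy.
left=> fin; apply: inf; apply: sub_finite_set fin => a /=.
by apply: contraNneq => y0; rewrite -lex0 -y0 (@theta_word_le _ _ _ G [:: a]).
Qed.

(** The condition [E (size s) = None] says that [s] labels the whole path, so infinite paths satisfy
    this vacuously. *)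
Definition singular_end r E : Prop :=
  forall s x, pmem r E s x -> E (size s) = None -> singular x.

Lemma pmem_extend r E s x n : pathlike r E -> pmem r E s x ->
  exists u y, pmem r E (s ++ u) y /\ ((n <= size u)%N \/ E (size (s ++ u)) = None).
Proof.
move=> rE sx; elim: n => [|n [u [y [uy uP]]]].
  by exists [::], x; rewrite cats0; split=> //; left.
case Eu : (E (size (s ++ u))) => [e|]; last by exists u, y; split=> //; right.
have {uP} un : (n <= size u)%N by case: uP => //; rewrite Eu.
have [v [z [vs vz]]] := pathlike_edge rE Eu.
have [|w vw] := pmem_comparable uy vz; first by rewrite vs.
exists (u ++ w), z; rewrite catA -vw; split=> //; left.
by rewrite vw !size_cat in vs *; lia.
Qed.

Lemma path_tight r E : pathlike r E -> singular_end r E -> tight G (pathlike_filter r E).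
Proof.
move=> rE sE; split; first exact: path_efilter.
move=> _ Z [s [x [-> Jx sx]]] [/finite_seqP[zs Zzs] Zle Zcov].
apply: contrapT => nZ.
have {}nZ e : Z e -> ~ pathlike_filter r E e by move=> Ze Pe; apply: nZ; exists e.
have Zform e : Z e -> e <> None -> exists t y,
    [/\ e = idem (s ++ t) y, ideal_word G (s ++ t) y, y != \bot & y <= theta_word G t x].
  move=> /Zle[[->//|[v [y [y0 Jy ->]]]]] /(sle_idemP _ _ _ _ y0)[t vt yx] _.
  by exists t, y; rewrite -vt.
(* If a cover [Z] missed the filter, the path could be followed along [s ++ u]
   beyond all words of [Z], or else to its end, where [y] in the vertex avoids all
   elements of [Z] whose words the path has passed. Then either [y] itself, or a
   subset of [y] killed by all letters, or the image of [y] under a letter not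
   occurring in [Z] is disjoint from [Z]. *)
have [u [y1 [uy1 uN]]] := pmem_extend
  (\max_(e <- zs) (if e is Some (t, _, _) then size t else 0%N)).+1 rE sx.
have [y [uy yx yZ]] : exists y, [/\ pmem r E (s ++ u) y, y <= theta_word G u x &
    forall t w C, idem (s ++ t) C \in zs -> u = t ++ w ->
    y `&` theta_word G w C = \bot].
  have : forall e, e \in zs -> Z e by move=> e; rewrite Zzs.
  (* Each element of [Z] whose word has been passed is removed from [y] in turn. If instead its meet
     with [y] were in the vertex, going back along [w] would put it into the filter. *)
  elim: zs {Zzs uN} => [|e zs IH] zsZ.
    by exists (theta_word G u x); split=> //; exact: theta_pmem rE sx uy1.
  have [|y [uy yx yZ]] := IH; first by move=> f fzs; apply: zsZ; rewrite inE fzs orbT.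
  have [[t [w [C [eE uE]]]]|nex] :=
      pselect (exists t w C, e = idem (s ++ t) C /\ u = t ++ w); last first.
    exists y; split=> // t w C; rewrite inE => /orP[/eqP eE uE|]; last exact: yZ.
    by case: nex; exists t, w, C.
  have Ze : Z e by apply: zsZ; rewrite mem_head.
  have [uyC|uyC] := pmem_split (theta_word G w C) uy.
    case: (nZ _ Ze); rewrite eE; apply/pathlike_filter_idem.
    have [t' [C' [e' JC' _ _]]] := Zform _ Ze (ltac:(by rewrite eE)).
    rewrite eE in e'; case: e' => tt' CC' _; rewrite -tt' -CC' in JC'; split=> //.
    apply: (@pmem_theta _ _ _ _ r E (s ++ t) w) => //.
    by rewrite -catA -uE; apply: pmem_le uyC (leIr _ _).
  exists (y `\` theta_word G w C); split=> //.
    by apply: le_trans yx; exact: leBx.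
  move=> t' w' C'; rewrite inE => /orP[|ezs uE'].
    move=> /eqP e' uE'; rewrite eE in e'; case: e' => tt' CC' uu'.
    have {}tt' : t = t' by move/eqP: tt'; rewrite eqseq_cat// eqxx => /eqP.
    have ww' : w = w' by move/eqP: uE'; rewrite uE tt' eqseq_cat// eqxx => /eqP.
    by rewrite -CC' -ww' diffIK.
  by apply/eqP; rewrite -lex0 -(yZ _ _ _ ezs uE') leI2// leBx.
have [y2 [Jy2 y2y uy2]] := pmem_ideal_le rE uy.
have y2x := le_trans y2y yx.
(* Elements of [Z] at words already passed are disjoint from [y], so one that meets a part of [y2]
   has a word properly extending [s ++ u]. *)
have meetZ z e : z != \bot -> z <= y2 -> Z e ->
    smul G (idem (s ++ u) z) e <> None ->
    exists b w C, e = idem (s ++ u ++ b :: w) C /\ theta_word G (b :: w) z != \bot.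
  move=> z0 zy2 Ze; case: (pselect (e = None)) => [->//|/(Zform _ Ze)[t [C [eE _ _ _]]]].
  have no w : u = t ++ w -> z `&` theta_word G w C = \bot.
    move=> uE; apply/eqP; rewrite -lex0 -(yZ t w C) ?leI2//.
      by apply: le_trans y2y.
    by rewrite -eE; move: Ze; rewrite Zzs.
  rewrite eE => /smul_neq0[[[|b w]]|[w]]; rewrite -?catA => /eqP;
    rewrite eqseq_cat// eqxx => /eqP.
  - rewrite cats0 => tu; have -> : C = theta_word G [::] C by [].
    by rewrite no ?eqxx// tu cats0.
  - move=> tE h; exists b, w, C; rewrite -tE; split=> //.
    by apply: contraNneq h => ->; rewrite meet0x.
  - by move=> uE; rewrite no ?eqxx.
have cov z : z != \bot -> z <= y2 ->
    exists b w C, Z (idem (s ++ u ++ b :: w) C) /\ theta_word G (b :: w) z != \bot.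
  move=> z0 zy2; have [|//||e Ze eu] := Zcov (idem (s ++ u) z).
  - by right; exists (s ++ u), z; split=> //; exact: ideal_word_le Jy2 zy2.
  - by apply/(sle_idemP _ _ _ _ z0); exists u => //; exact: le_trans y2x.
  by have [b [w [C [eE h]]]] := meetZ _ _ z0 zy2 Ze eu; exists b, w, C; rewrite -eE.
(* Either [u] is longer than every word of [Z], against [cov], or the path ends after [s ++ u], so
   that [y2] is singular. *)
have [uN'|/(sE _ _ uy2)] := uN.
  have [b [w [C []]]] := cov y2 (pmem_neq0 uy2) (lexx _).
  rewrite Zzs /= => CZ _; move: uN'; rewrite ltnNge => /negP; apply.
  have := @leq_bigmax_seq _ _ xpredT (fun e : @triple disp B L =>
    if e is Some (t, _, _) then size t else 0%N) _ CZ isT.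
  by apply: leq_trans; rewrite /= !size_cat addnCA leq_addr.
case=> [inf|[z [z0 zy2 zs0]]]; last first.
  have [b [w [C [_]]]] := cov z z0 zy2.
  by rewrite /= zs0 theta_word0 eqxx.
(* The letter following the first [size (s ++ u)] letters of a word. Finitely many arise from [Z],
   and every letter acting nontrivially on [y2] is shown to be among them. *)
pose letter (e : @triple disp B L) :=
  if e is Some (t, _, _) then onth t (size (s ++ u)) else None.
apply: inf; apply: (@sub_finite_set _ _ [set` pmap letter zs]); last exact: finite_seq.
move=> a /= a0; rewrite mem_pmap.
have [|//||e Ze eu] := Zcov (idem (s ++ u ++ [:: a]) (theta G a y2)).
- right; exists (s ++ u ++ [:: a]), (theta G a y2); split=> //.
  by rewrite catA; exact: (@ideal_word_cat _ _ _ _ _ [:: a]).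
- apply/(sle_idemP _ _ _ _ a0); exists (u ++ [:: a]) => //.
  by rewrite theta_word_cat (@theta_word_le _ _ _ G [:: a]).
apply/mapP; exists e; first by move: Ze; rewrite Zzs.
case: (pselect (e = None)) => [e0|/(Zform _ Ze)[t [C [eE _ _ _]]]].
  by rewrite e0 in eu.
have onthE v : onth ((s ++ u ++ a :: v)) (size (s ++ u)) = Some a.
  by rewrite catA onth_cat ltnn subnn.
move: eu; rewrite eE => /smul_neq0[[w tE _]|[w]].
  by rewrite /letter /idem tE -!catA cat1s onthE.
case: (lastP w) => [|w' b].
  by rewrite cats0 => <- _; rewrite /letter /idem onthE.
(* Here the word of [e] has already been passed: the meet is the image under [a] of the meet of [y2]
   with an image of [C], which is empty. *)
rewrite -cats1 -catA => /eqP; rewrite eqseq_cat// eqxx /= catA !cats1 eqseq_rcons.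
move=> /andP[/eqP uE /eqP ab]; subst b.
rewrite -cats1 theta_word_cat /= -(theta_wordI _ [:: a]) /=.
suff -> : y2 `&` theta_word G w' C = \bot.
  by have := theta_word0 G [:: a]; rewrite /= => ->; rewrite eqxx.
apply/eqP; rewrite -lex0 -(yZ t w' C) ?leI2//.
by rewrite -eE; move: Ze; rewrite Zzs.
Qed.

(** * Slices of tight filters *)

Lemma tight_efilter xi : tight G xi -> efilter G xi.
Proof. by case. Qed.

Lemma efilter_le xi s t x y : efilter G xi -> xi (idem (s ++ t) y) ->
  ideal_word G s x -> y <= theta_word G t x -> xi (idem s x).
Proof.
move=> xiF xiy Jx yx; have [_ _ xile _ _] := xiF.
have [y0 _] := efilter_idemP xiF xiy.
apply: xile xiy _ _; last by apply/(sle_idemP _ _ _ _ y0); exists t.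
right; exists s, x; split=> //; apply: (@theta_word_neq0 _ _ _ G t).
by apply: contraNneq y0 => y0; rewrite -lex0 -y0.
Qed.

Lemma efilter_le0 xi s x y : efilter G xi -> xi (idem s y) ->
  ideal_word G s x -> y <= x -> xi (idem s x).
Proof. by move=> xiF xiy; apply: (@efilter_le xi s [::]); rewrite ?cats0. Qed.

Lemma efilterI xi s x y : efilter G xi -> xi (idem s x) -> xi (idem s y) ->
  xi (idem s (x `&` y)).
Proof.
move=> xiF xix xiy; have [u [z [xiz [v uv zx] [v' uv' zy]]]] := efilter_dir xiF xix xiy.
have vv' : v = v' by move/eqP: uv'; rewrite uv eqseq_cat// eqxx => /eqP.
subst v'; rewrite uv in xiz; apply: (efilter_le xiF xiz).
  by have [_ Jx] := efilter_idemP xiF xix; apply: ideal_word_le Jx (leIl _ _).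
by rewrite theta_wordI lexI zx zy.
Qed.

Lemma efilter_theta xi s t x y : efilter G xi -> xi (idem s x) ->
  xi (idem (s ++ t) y) -> xi (idem (s ++ t) (theta_word G t x)).
Proof.
move=> xiF xix xiy; have [u [z [xiz [v uv zx] [v' uv' zy]]]] := efilter_dir xiF xix xiy.
have vv' : v = t ++ v' by move/eqP: uv'; rewrite uv -catA eqseq_cat// eqxx => /eqP.
rewrite uv' in xiz; apply: (efilter_le xiF xiz).
  by have [_ Jx] := efilter_idemP xiF xix; exact: ideal_word_cat.
by rewrite -theta_word_cat -vv'.
Qed.

(** For [y] outside the slice, the meet and the difference of [x] and [y] form a cover of
    [idem s x]. The filter contains one of them, which can only be the difference; [triple_norm]
    sends an empty part to zero. *)
Lemma tight_slice_ultra xi s x : tight G xi -> xi (idem s x) ->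
  ultra G s [set y | xi (idem s y)].
Proof.
move=> [xiF xiT] xix; have [x0 Jx] := efilter_idemP xiF xix.
apply: disjoint_poset_ultrafilter.
  split=> [y /(efilter_idemP xiF)[]//||||].
  - by exists x.
  - by move=> y z xiy Jz; exact: efilter_le0.
  - move=> y z xiy xiz; exists (y `&` z); split; [exact: efilterI|exact: leIl|exact: leIr].
  - by move=> /(efilter_idemP xiF)[]; rewrite eqxx.
move=> y Jy nxiy; exists (x `\` y); last exact: diffKI.
have [|e [Ze xie]] := xiT (idem s x)
    [set triple_norm s (x `&` y) s; triple_norm s (x `\` y) s] xix; last first.
  case: Ze => eE; move: xie; rewrite eE /triple_norm.
    case: ifP => _ xie; first by have [_ _ _ _ []] := xiF.
    by case: nxiy; apply: (efilter_le0 xiF xie) => //; exact: leIr.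
  by case: ifP => _ xie //; have [_ _ _ _ []] := xiF.
split.
- exact: finite_set2.
- have le z : z <= x -> idempotents G (triple_norm s z s) /\ sle G (triple_norm s z s) (idem s x).
    rewrite /triple_norm => zx; case: ifP => [_|/negbT z0]; first by split; [left|].
    split; last by apply/(sle_idemP _ _ _ _ z0); exists [::]; rewrite ?cats0.
    by right; exists s, z; split=> //; exact: ideal_word_le zx.
  by move=> e [->|->]; apply: le; [exact: leIl|exact: leBx].
- move=> _ [->//|[t [z [z0 Jz ->]]]] _ /(sle_idemP _ _ _ _ z0)[u -> zx].
  have [h|h] := eqVneq (z `&` theta_word G u (x `&` y)) \bot; last first.
    exists (triple_norm s (x `&` y) s); first by left.
    rewrite triple_norm_idem; first exact: smul_catl_neq0.
    apply: contraNneq h => ->; by rewrite theta_word0 meetx0.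
  have {}h : z `&` theta_word G u (x `\` y) != \bot.
    apply: contraNneq z0 => h'; move: zx => /meet_idPl <-.
    rewrite -(joinIB (theta_word G u y) (theta_word G u x)) meetUr.
    by rewrite -theta_wordI -theta_wordB h h' joinxx.
  exists (triple_norm s (x `\` y) s); first by right.
  rewrite triple_norm_idem; first exact: smul_catl_neq0.
  by apply: contraNneq h => ->; rewrite theta_word0 meetx0.
Qed.

(** * Associated words, shifts, and the path of a tight filter *)

Lemma efilter_assoc_word xi : efilter G xi -> exists w, assoc_word xi w.
Proof.
move=> xiF; have comp s t x y : xi (idem s x) -> xi (idem t y) ->
    (size s <= size t)%N -> exists u, t = s ++ u.
  move=> xix xiy st; have [u [z [_ [v uv _] [v' uv' _]]]] := efilter_dir xiF xix xiy.
  have /prefixP[w tw] : prefix s t.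
    by rewrite prefixE -(takel_cat v' st) -uv' uv take_size_cat.
  by exists w.
have [[N bnd]|unb] := pselect (exists N, forall s x, xi (idem s x) -> (size s <= N)%N).
  pose P n := `[< exists s x, xi (idem s x) /\ size s = n >].
  have exP : exists n, P n.
    have [_ [e xie] _ _ _] := xiF; have [s [x [_ _ eE]]] := efilter_idem xiF xie.
    by exists (size s); apply/asboolP; exists s, x; rewrite -eE.
  have Pbnd n : P n -> (n <= N)%N by move=> /asboolP[s [x [xix <-]]]; exact: bnd xix.
  have [_ /asboolP[s [x [xix <-]]] smax] := ex_maxnP exP Pbnd.
  exists (Fin s); split; first by exists x.
  by move=> t y xiy; apply: smax; apply/asboolP; exists t, y.
have {}unb n : exists t, (exists x, xi (idem t x)) /\ (n <= size t)%N.
  apply: contrapT => nex; apply: unb; exists n => s x xix.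
  by rewrite leqNgt; apply/negP => /ltnW ns; apply: nex; exists s; split=> //; exists x.
have [T TP] := choice unb.
case T1 : (T 1%N) => [|d t1]; first by have [_] := TP 1%N; rewrite T1.
(* Letters are counted from 0, so the one at [n] is read off [T n.+1], whose length exceeds [n]; the
   default [d] is never reached. *)
exists (Inf (fun n => nth d (T n.+1) n)); split.
  by move=> n; have [[x xix] nt] := TP n; exists (T n), x.
move=> t y xiy; apply: (@eq_from_nth _ d); first by rewrite size_mkseq.
move=> i it; rewrite nth_mkseq//; have [[x xix] iT] := TP i.+1.
have [/(comp _ _ _ _ xix xiy)[u ->]|/ltnW/(comp _ _ _ _ xiy xix)[u ->]] :=
  leqP (size (T i.+1)) (size t).
  by rewrite nth_cat iT.
by rewrite nth_cat it.
Qed.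

Lemma assoc_word_first xi a s x : efilter G xi -> xi (idem (a :: s) x) ->
  exists w, assoc_word xi (word_cons a w).
Proof.
move=> xiF xix; have [w xiw] := efilter_assoc_word xiF.
have [ws wt] := assoc_word_take xiF xiw xix.
have /word_consP[b [v vE]] : word_size_ge 1 w by case: (w) ws => //= u; exact: leq_trans.
move: wt; rewrite vE /= word_take_cons => -[-> _].
by exists v; rewrite -vE.
Qed.

(** The element at [a :: s'] fixes the first letter of the associated word, so the shift can be
    described without mentioning that word. *)
Lemma shift_idem xi a s x s' y : efilter G xi -> xi (idem (a :: s') y) ->
  shift_filter G xi (idem s x) <->
  ideal_word G s x /\ exists2 z, xi (idem (a :: s) z) & z <= x.
Proof.
move=> xiF xiy; have [w xiw] := assoc_word_first xiF xiy.
rewrite (shift_filterE _ xiF xiw); split=> [[t [z [Jz [u xiu uz] [-> -> _]]]]|[Jx xz]].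
  by split=> //; exists u.
by exists s, x.
Qed.

Lemma shift_idem_first xi e : efilter G xi -> shift_filter G xi e ->
  exists a x, xi (idem [:: a] x).
Proof.
move=> xiF [a [w [n [y [xiw _ _ [x [_]]]]]]]; rewrite word_take_cons => xix _ _.
have [_ Jx] := efilter_idemP xiF xix.
have [z Jz xz] := @ideal_word_catP _ _ _ G a [::] _ _ Jx.
by exists a, z; exact: (@efilter_le xi [:: a] (word_take n w) z x xiF xix).
Qed.

(** For tight [xi] the slice at the empty word is an ultrafilter or empty; in the second case
    [insub] returns the point at infinity. *)
Definition root xi : F0 G := insub [set x | xi (idem [::] x)].

Definition is_first xi (e : E1 G) : Prop :=
  forall x, val (projT2 e) x <-> xi (idem [:: projT1 e] x).

Definition first xi : option (E1 G) :=
  if pselect (exists e, is_first xi e) is left h then Some (projT1 (cid h)) else None.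

Lemma firstP xi e : first xi = Some e -> is_first xi e.
Proof. by rewrite /first; case: pselect => // h [<-]; case: cid. Qed.

Lemma first_idem xi e : first xi = Some e -> exists x, xi (idem [:: projT1 e] x).
Proof.
move=> he; have h := firstP he; have [[_ [x ex] _ _ _] _] := set_valP (projT2 e).
by exists x; apply/h.
Qed.

Lemma idem_first xi a s x : tight G xi -> xi (idem (a :: s) x) ->
  exists2 e, first xi = Some e & projT1 e = a.
Proof.
move=> xiT xix; have xiF := tight_efilter xiT.
have [_ Jx] := efilter_idemP xiF xix.
have [y Jy xy] := @ideal_word_catP _ _ _ G a [::] _ _ Jx.
have xiy : xi (idem [:: a] y) by exact: (@efilter_le xi [:: a] s y x).
have FU := tight_slice_ultra xiT xiy.
rewrite /first; case: pselect => [h|[]]; last first.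
  pose F : uspace G [:: a] := exist (fun X => X \in ultra G [:: a]) _ (mem_set FU).
  by exists (existT (fun a => uspace G [:: a]) a F).
exists (projT1 (cid h)) => //; case: cid => e /= eP.
have [[_ [z ez] _ _ _] _] := set_valP (projT2 e); move/eP : ez => xiz.
have [u [v [_ [w uw _] [w' uw' _]]]] := efilter_dir xiF xix xiz.
by move: uw'; rewrite uw => -[].
Qed.

Lemma root_idem xi x : tight G xi ->
  (exists2 v, root xi = Some v & val v x) <-> xi (idem [::] x).
Proof.
move=> xiT; rewrite /root; split.
  by move=> [v]; case: insubP => // u _ uE [<-]; rewrite uE.
move=> xix; case: insubP => [u _ uE|/negP[]]; first by exists u; rewrite ?uE.
by rewrite inE; exact: tight_slice_ultra xix.
Qed.

Lemma rmap_first xi e : tight G xi -> first xi = Some e -> rmap e = root xi.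
Proof.
move=> xiT xie; rewrite /rmap /root; congr insub; apply/seteqP.
have xiF := tight_efilter xiT; have eP := firstP xie; have [z xiz] := first_idem xie.
split=> x; rewrite /rset /= eP => h.
  exact: (@efilter_le xi [::] [:: projT1 e] x _ xiF h).
exact: (@efilter_theta xi [::] [:: projT1 e] x z).
Qed.

Lemma root_shift xi e : tight G xi -> first xi = Some e ->
  root (shift_filter G xi) = Some (dmap e).
Proof.
move=> xiT xie; rewrite /root; have eP := firstP xie; have [z xiz] := first_idem xie.
suff -> : [set x | shift_filter G xi (idem [::] x)] = val (dmap e) by rewrite valK.
apply/seteqP; split=> x /=; rewrite (shift_idem _ _ (tight_efilter xiT) xiz).
  by move=> [_ [y xiy yx]]; exists y => //; apply/eP.
by move=> [y /eP xiy yx]; split=> //; exists y.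
Qed.

(** Once the associated word is exhausted, the iterated shifts are empty and [first] returns
    [None]. *)
Definition edges xi : nat -> option (E1 G) := fun i => first (iter i (shift_filter G) xi).

Lemma tail_edges xi : tail (edges xi) = edges (shift_filter G xi).
Proof. by apply/funext => i; rewrite /tail /edges iterSr. Qed.

Lemma shift_tight_idem xi a s x : tight G xi -> xi (idem (a :: s) x) ->
  tight G (shift_filter G xi).
Proof.
move=> xiT xix; have [w xiw] := assoc_word_first (tight_efilter xiT) xix.
exact: shift_tight (tight_efilter xiT) xiw xiT.
Qed.

(** Induction on the word: the tail of the path belongs to the shifted filter, whose root is the
    vertex of the first edge. Hence a tight filter is recovered from its path. *)
Lemma tight_pmem xi s x : tight G xi -> ideal_word G s x ->
  pmem (root xi) (edges xi) s x <-> xi (idem s x).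
Proof.
elim: s xi x => [|a s IH] xi x xiT Jx; first exact: root_idem.
have xiF := tight_efilter xiT; have Js := ideal_word_behead Jx.
rewrite /= tail_edges /edges /=; split=> [[e [xie ea]]|xix].
  have [z xiz] := first_idem xie; rewrite ea in xiz.
  rewrite -(root_shift xiT xie) IH//; last exact: shift_tight_idem xiz.
  by rewrite (shift_idem _ _ xiF xiz) => -[_ [y xiy yx]]; exact: efilter_le0 yx.
have [e xie ea] := idem_first xiT xix; exists e; split=> //.
rewrite -(root_shift xiT xie) IH//; last exact: shift_tight_idem xix.
by rewrite (shift_idem _ _ xiF xix); split=> //; exists x.
Qed.

(** The element [e] excludes the iterates past the end of the word, which are empty and thus no
    filters. *)
Lemma iter_shift_tight xi i e : tight G xi -> iter i (shift_filter G) xi e ->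
  tight G (iter i (shift_filter G) xi).
Proof.
move=> xiT; elim: i e => [//|i IH] e /= /[dup] sh [a [w [n [y [_ _ _ [x [_ xix] _] _]]]]].
have xT := IH _ xix.
by have [b [z xiz]] := shift_idem_first (tight_efilter xT) sh; exact: shift_tight_idem xiz.
Qed.

Lemma tight_pathlike xi : tight G xi -> pathlike (root xi) (edges xi).
Proof.
move=> xiT; have xiF := tight_efilter xiT; split.
- move=> E0 r0; have [_ [e xie] _ _ _] := xiF.
  have [[|a s] [x [_ _ eE]]] := efilter_idem xiF xie; rewrite eE in xie.
    by move/(root_idem _ xiT) : xie => [v]; rewrite r0.
  by have [f] := idem_first xiT xie; rewrite -[first xi]/(edges xi 0) E0.
- by move=> e; exact: rmap_first.
- move=> i e; rewrite /edges /= => shE; have [x shx] := first_idem shE.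
  set z := iter i _ xi in shE shx *.
  have zT : tight G z.
    have := shx; move=> [a [w [n [y [_ _ _ [x' [_ xix] _] _]]]]].
    exact: iter_shift_tight xix.
  have [a [y zy]] := shift_idem_first (tight_efilter zT) shx.
  have [e' ze' _] := idem_first zT zy; exists e' => //.
  rewrite -(root_shift zT ze'); apply: rmap_first shE.
  exact: shift_tight_idem zy.
Qed.

(** If [y] were not singular, its nonzero images under single letters would form a finite cover of
    [idem s y]; tightness would then give an element at a longer word, hence an edge after the
    end. *)
Lemma tight_singular_end xi : tight G xi -> singular_end (root xi) (edges xi).
Proof.
move=> xiT s x sx Es; have rE := tight_pathlike xiT.
have [y [Jy yx sy]] := pmem_ideal_le rE sx.
apply: (singular_le _ yx) => {x yx sx}; apply: contrapT => /not_orP[].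
move=> /contrapT fin nex; have [xiF xiC] := xiT.
have xiy : xi (idem s y) by exact/tight_pmem.
have [|e [[a a0 <-] xia]] := xiC (idem s y)
    ((fun a => idem (s ++ [:: a]) (theta G a y)) @` [set a | theta G a y != \bot]) xiy; last first.
  have [_ Ja] := efilter_idemP xiF xia.
  move/(tight_pmem xiT Ja) : xia => /(pmem_edge (i := size s)).
  by rewrite size_cat addn1 ltnSn => /(_ isT)[f]; rewrite Es.
split; first exact: finite_image.
- move=> _ [a a0 <-]; split; last by apply/(sle_idemP _ _ _ _ a0); exists [:: a].
  right; exists (s ++ [:: a]), (theta G a y); split=> //.
  exact: (@ideal_word_cat _ _ _ _ _ [:: a]).
- move=> _ [->//|[t [z [z0 Jz ->]]]] _ /(sle_idemP _ _ _ _ z0)[[|a u] -> zy].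
    rewrite cats0; have [a za] : exists a, theta G a z != \bot.
      apply: contrapT => /forallNP za; apply: nex; exists z; split=> // a.
      by apply/eqP; have /negP := za a; rewrite negbK.
    have ay : theta G a z <= theta G a y by exact: (@theta_word_le _ _ _ G [:: a]).
    exists (idem (s ++ [:: a]) (theta G a y)).
      by exists a => //; apply: contraNneq za => y0; rewrite -lex0 -y0.
    by apply: smul_catr_neq0 => /=; move/meet_idPl : ay => ->.
  exists (idem (s ++ [:: a]) (theta G a y)).
    exists a => //; apply: (@theta_word_neq0 _ _ _ G u).
    by apply: contraNneq z0 => y0; rewrite -lex0 -y0.
  have -> : s ++ a :: u = (s ++ [:: a]) ++ u by rewrite -catA.
  by apply: smul_catl_neq0; move/meet_idPl : zy => /= ->.
Qed.

End TightFilters.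

(** * Singular vertices *)

Section SingularVertices.
Context {disp : Order.disp_t} {B : cbDistrLatticeType disp} {L : choiceType}.
Variable G : gbds B L.
Implicit Types (s t : seq L) (x y : B).

(** * Neighbourhoods and compactness in the spaces of vertices and edges *)

Lemma ubase_open s x : ideal_word G s x -> open (@ubase _ _ _ G s x).
Proof.
move=> Jx; exists [set ubase x]; first by move=> _ ->; exists x.
by rewrite bigcup_set1.
Qed.

Lemma uspace_nbhsP s (F : uspace G s) (U : set (uspace G s)) :
  nbhs F U <-> exists x, [/\ ideal_word G s x, val F x & ubase x `<=` U].
Proof.
rewrite nbhsE; split=> [[V [[D DJ <-] [W DW WF]] VU]|[x [Jx Fx xU]]].
  have [x Jx xW] := DJ _ DW; exists x; split=> //; first by rewrite -xW in WF.
  by rewrite xW; apply: subset_trans VU => F' WF'; exists W.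
by exists (ubase x) => //; split=> //; exact: ubase_open.
Qed.

(** An ultrafilter [FF] of subsets converges to the set of all [y] with [ubase y] in [FF], which is
    itself an ultrafilter in the ideal. *)
Lemma ubase_compact s x : ideal_word G s x -> compact (@ubase _ _ _ G s x).
Proof.
move=> Jx; rewrite compact_ultra => FF FFU FFx.
have JI := ideal_word_ideal G s.
pose X := [set y | ideal_word G s y /\ FF (ubase y)].
have XI y z : X y -> X z -> X (y `&` z).
  move=> [Jy Fy] [Jz Fz]; split; first by apply: ideal_word_le Jy (leIl _ _).
  by apply: filterS (filterI Fy Fz) => F [hy hz]; exact: ultraI JI (set_valP F) hy hz.
have XU : ultra G s X.
  apply: disjoint_poset_ultrafilter.
    split=> [y []|||y z Xy Xz|[_]] //.
    - by exists x.
    - move=> y z [Jy Fy] Jz yz; split=> //; apply: filterS Fy => F Fy.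
      exact: ultra_le (set_valP F) Fy Jz yz.
    - by exists (y `&` z); split; [exact: XI|exact: leIl|exact: leIr].
    - by move=> /filter_ex[F /(ultra_neq0 (set_valP F))]; rewrite eqxx.
  move=> y Jy nXy; exists (x `\` y); last exact: diffKI.
  split; first by apply: ideal_word_le Jx (leBx _ _).
  have [Fy|Fy] := in_ultra_setVsetC (ubase y) FFU; first by case: nXy.
  apply: filterS (filterI FFx Fy) => F [hx hy].
  have [hxy|//] := ultra_split y JI (set_valP F) hx.
  by case: hy; apply: ultra_le (set_valP F) hxy Jy (leIr _ _).
exists (exist (fun F => F \in ultra G s) X (mem_set XU)); split; first by split.
move=> U /uspace_nbhsP[y [Jy [_ FFy] yU]]; exact: filterS yU FFy.
Qed.

Lemma edge_nbhsP (e : E1 G) (U : set (E1 G)) :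
  nbhs e U <-> exists x, [/\ ideal G (projT1 e) x, dset e x &
    forall e', projT1 e' = projT1 e -> dset e' x -> U e'].
Proof.
case: e => a F /=; split=> [h|[x [Jx ex xU]]].
  have {h} /uspace_nbhsP[x] : nbhs F (existT (fun a => uspace G [:: a]) a @^-1` U) by [].
  rewrite ideal_word1 => -[Jx Fx xU]; exists x; split=> //; first by exists x.
  by move=> [b F'] /= ba; subst b => /(dsetE (e := existT _ a F') Jx) /xU.
change (nbhs F (existT (fun a => uspace G [:: a]) a @^-1` U)).
apply/uspace_nbhsP; exists x; rewrite ideal_word1; split=> //.
  exact/(dsetE (e := existT _ a F)).
by move=> F' F'x; apply: xU => //; exists x.
Qed.

(** In both cases of [F0_open] the map [Some] is an open embedding, so near a vertex only the base
    of E^0 counts. *)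
Lemma F0_nbhsP (v : E0 G) (U : set (F0 G)) :
  nbhs (Some v : F0 G) U <->
  exists x, val v x /\ forall w : E0 G, val w x -> U (Some w).
Proof.
have some_open (V : set (E0 G)) : open V -> @F0_open _ _ _ G (Some @` V).
  rewrite /F0_open; case: ifP => _ oV; last exact: one_point_compactification_open_some.
  suff -> : Some @^-1` [set Some x | x in V] = V by [].
  by apply/seteqP; split=> w /=; [case=> w' Vw' [<-]|exists w].
have open_some (V : set (F0 G)) : F0_open V -> open (Some @^-1` V : set (E0 G)).
  rewrite /F0_open; case: ifP => // _ oV.
  by apply: open_comp oV => w _; exact: one_point_compactification_some_continuous.
rewrite nbhsE; split=> [[V [oV Vv] VU]|[x [vx xU]]].
  have : nbhs v (Some @^-1` V) by apply: open_nbhs_nbhs; split=> //; exact: open_some.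
  by move=> /uspace_nbhsP[x [_ vx xV]]; exists x; split=> // w wx; exact/VU/xV.
exists (Some @` (ubase x : set (E0 G))); last by move=> _ [w wx <-]; exact: xU.
split; last by exists v.
by apply: some_open; exact: ubase_open.
Qed.

Lemma edge_exists a x : ideal G a x -> x != \bot ->
  exists2 e : E1 G, projT1 e = a & dset e x.
Proof.
rewrite -ideal_word1 => Jx x0.
have [F FU Fx] := ultra_exists (ideal_word_ideal G [:: a]) Jx x0.
pose F' : uspace G [:: a] := exist (fun X => X \in ultra G [:: a]) _ (mem_set FU).
by exists (existT (fun a => uspace G [:: a]) a F') => //; exists x.
Qed.

Lemma vertex_exists x : x != \bot -> exists v : E0 G, val v x.
Proof.
move=> x0; have [F FU Fx] := ultra_exists (ideal_word_ideal G [::]) I x0.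
by exists (exist (fun X => X \in ultra G [::]) _ (mem_set FU)).
Qed.

Lemma E0_rgP (v : E0 G) : F0_rg G (Some v) <-> exists2 x, val v x & ~ singular G x.
Proof.
split=> [[[V vV cV] nsce]|[x vx nsx]].
  have [x1 [vx1 x1V]] := (F0_nbhsP v V).1 vV.
  have [W vW Wsce] : exists2 W, nbhs (Some v : F0 G) W & F0_sce G `&` W = set0.
    apply: contrapT => nex; apply: nsce => W vW; apply/set0P/eqP => W0.
    by apply: nex; exists W.
  have [x2 [vx2 x2W]] := (F0_nbhsP v W).1 vW.
  exists (x1 `&` x2).
    exact: ultraI (ideal_word_ideal G [::]) (set_valP v) vx1 vx2.
  have sub (w : E0 G) : val w (x1 `&` x2) -> val w x1 /\ val w x2.
    by move=> h; split; apply: ultra_le (set_valP w) h I _; [exact: leIl|exact: leIr].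
  move=> [inf|[y [y0 yx ys]]].
    (* Compactness is used along finite lists of letters ordered by inclusion: the letter of an edge
       is locally constant, so one list contains all letters of edges in the preimage of [V]. *)
    pose FF := filter_from [set: seq L] (fun s => [set t : seq L | {subset s <= t}]).
    have FFF : Filter FF.
      apply: filter_from_filter; first by exists [::].
      move=> s t _ _; exists (s ++ t) => // u stu.
      by split=> a ha; apply: stu; rewrite mem_cat ha ?orbT.
    have [|t _ /(_ t (fun a => id)) tcov] := (compact_near_coveringP _).1 cV
        _ FF (fun (t : seq L) e => projT1 e \in t) FFF.
      move=> e _; exists ([set e' : E1 G | projT1 e' = projT1 e],
        [set t : seq L | projT1 e \in t]) => /=.
        split; last by exists [:: projT1 e] => // t; apply; exact: mem_head.
        apply/edge_nbhsP; have [[FJ [z Fz] _ _ _] _] := set_valP (projT2 e).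
        exists z; split; [|by exists z|by []].
        by rewrite -ideal_word1; exact: FJ.
      by move=> [e' u] [/= ->].
    apply: inf; apply: (@sub_finite_set _ _ [set` t]); last exact: finite_seq.
    move=> a a0; have [e ea ex] := edge_exists (theta_ideal G a _) a0.
    rewrite -ea; apply: tcov; rewrite -ea in ex.
    have [w ew wx] := (rmap_dset e _).2 ex.
    by rewrite /preimage /= ew; apply: x1V; have [] := sub _ wx.
  (* A vertex containing [y] lies in [W], hence in the closure of the range; but an edge whose range
     contains [y] would have the image of [y], which is empty, in its vertex. *)
  have [w wy] := vertex_exists y0.
  have wx : val w (x1 `&` x2) by exact: ultra_le (set_valP w) wy I yx.
  have : closure (range (@rmap _ _ _ G)) (Some w).
    apply: contrapT => sw; have : (F0_sce G `&` W) (Some w).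
      by split=> //; apply: x2W; have [] := sub _ wx.
    by rewrite Wsce.
  move=> /(_ [set u | exists2 v, u = Some v & val v y])[].
    by apply/F0_nbhsP; exists y; split=> // u uy; exists u.
  move=> _ [[e _ <-] /rmap_dset]; rewrite ys => /(ultra_neq0 (set_valP (dmap e))).
  by rewrite eqxx.
have fin : finite_set [set a | theta G a x != \bot] by apply: contrapT => inf; apply: nsx; left.
split.
  exists [set u | exists2 v, u = Some v & val v x].
    by apply/F0_nbhsP; exists x; split=> // w wx; exists w.
  (* The preimage of the neighbourhood is a finite union of basic compact sets, one for each letter
     not killing [x]. *)
  pose C a := existT (fun a => uspace G [:: a]) a @` ubase (theta G a x).
  suff -> : @rmap _ _ _ G @^-1` [set u | exists2 v, u = Some v & val v x] =
      \bigcup_(a in [set a | theta G a x != \bot]) C a.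
    rewrite -fsbig_setU//; apply: big_rec; first exact: compact0.
    move=> a K _ KC; apply: compactU => //; apply: continuous_compact.
      by apply: continuous_subspaceT => F U.
    by apply: ubase_compact; rewrite ideal_word1; exact: theta_ideal.
  apply/seteqP; split=> e.
    move=> /rmap_dset ex; exists (projT1 e); first exact: ultra_neq0 (set_valP (dmap e)) ex.
    move/(dsetE (theta_ideal G _ _)) : ex; case: e => a F /= Fx; by exists F.
  move=> [a _ [F Fx <-]]; apply/rmap_dset; exact/dsetE/Fx/theta_ideal.
move=> /(_ [set u | exists2 v, u = Some v & val v x])[].
  by apply/F0_nbhsP; exists x; split=> // w wx; exists w.
move=> u [+ [w uw wx]]; rewrite uw => sw; apply: sw => U /F0_nbhsP[y [wy yU]].
(* A letter killing no smaller meet exists unless [x] is singular; it yields an edge whose range is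
   in the given neighbourhood of [w], so [w] is in the closure of the range. *)
have [a a0] : exists a, theta G a (x `&` y) != \bot.
  apply: contrapT => /forallNP all0; apply: nsx; right; exists (x `&` y); split.
  - exact: ultra_neq0 (set_valP w) (ultraI (ideal_word_ideal G [::]) (set_valP w) wx wy).
  - exact: leIl.
  - by move=> a; apply: contrapT => h; apply: (all0 a); apply/eqP.
have [e ea ex] := edge_exists (theta_ideal G a _) a0; rewrite -ea in ex.
have [v' ev v'x] := (rmap_dset e _).2 ex.
exists (Some v'); split; first by exists e.
by apply: yU; exact: ultra_le (set_valP v') v'x I (leIr _ _).
Qed.

Lemma E0_sgP (v : E0 G) : E0_sg G v <-> forall x, val v x -> singular G x.
Proof.
split=> [sg x vx|sg /E0_rgP[x vx]]; last by apply; exact: sg.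
by apply: contrapT => nsx; apply: sg; apply/E0_rgP; exists x.
Qed.

End SingularVertices.

(** * Finite paths and boundary paths *)

Section BoundaryPaths.
Context {disp : Order.disp_t} {B : cbDistrLatticeType disp} {L : choiceType}.
Variable G : gbds B L.
Implicit Types (r : F0 G) (E : nat -> option (E1 G)) (s t : seq L) (x y : B).
Implicit Types (nu : Estar G) (mu : boundary G).

Lemma pmem_rcons r E s a x : pmem r E (rcons s a) x ->
  exists e, [/\ E (size s) = Some e, projT1 e = a & dset e x].
Proof.
elim: s r E => [|b s IH] r E /= [e [E0 ea]]; last exact: IH.
by move=> [v [<-] ex]; exists e.
Qed.

(** Membership after a word depends only on the letters of the path and on its last edge, so the
    path may vary with [x] kept in its last vertex. *)
Lemma pmem_labels r E r' E' s a x y : pmem r E (rcons s a) y ->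
  (forall i, (i <= size s)%N -> omap (@projT1 _ _) (E i) = omap (@projT1 _ _) (E' i)) ->
  (exists2 e, E' (size s) = Some e & dset e x) -> pmem r' E' (rcons s a) x.
Proof.
elim: s r E r' E' => [|b s IH] r E r' E' /= [f [E0 fa fy]] EE'.
  move=> [e E'0 ex]; exists e; split=> //; last by exists (dmap e).
  by have := EE' 0%N isT; rewrite E0 E'0 => -[<-].
move=> Es; have := EE' 0%N isT; rewrite E0; case E'0 : (E' 0%N) => [f'|//] [ff'].
exists f'; split; rewrite -?ff' //; apply: IH fy _ Es => i; exact: EE' i.+1.
Qed.

Lemma pmem_last r E s a x y e : pmem r E (rcons s a) y -> E (size s) = Some e ->
  dset e x -> pmem r E (rcons s a) x.
Proof. by move=> sy Es ex; apply: pmem_labels sy _ _ => //; exists e. Qed.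

Lemma pmem_ultra r E s x : pathlike r E -> pmem r E s x ->
  ultra G s [set y | ideal_word G s y /\ pmem r E s y].
Proof.
move=> rE sx; have JI := ideal_word_ideal G s.
have [x' [Jx' _ sx']] := pmem_ideal_le rE sx.
apply: disjoint_poset_ultrafilter.
  split=> [y []|||y z [Jy sy] [Jz sz]|[_ /pmem_neq0]] //.
  - by exists x'.
  - by move=> y z [_ sy] Jz yz; split=> //; exact: pmem_le sy yz.
  - exists (y `&` z); split; [split|exact: leIl|exact: leIr].
      exact: ideal_word_le Jy (leIl _ _).
    exact: pmemI.
  - by rewrite eqxx.
move=> y Jy nsy; exists (x' `\` y); last exact: diffKI.
split; first exact: ideal_word_le Jx' (leBx _ _).
have [sxy|//] := pmem_split y sx'.
by case: nsy; split=> //; apply: pmem_le sxy (leIr _ _).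
Qed.

(** * Finite paths as sequences of edges *)

Lemma Estar_edge_ord n (e : En G n.+1) (i : 'I_n.+1) :
  Estar_edge (path_of e) i = Some (val (e : set_type (@composable _ _ _ G n.+1)) i).
Proof. by rewrite /= valK. Qed.

Lemma Estar_edgeE n (e : En G n.+1) i (ni : (i < n.+1)%N) :
  Estar_edge (path_of e) i = Some (val (e : set_type (@composable _ _ _ G n.+1)) (Ordinal ni)).
Proof. exact: (Estar_edge_ord e (Ordinal ni)). Qed.

Lemma Estar_edge_lt nu i : (i < projT1 nu)%N -> exists e, Estar_edge nu i = Some e.
Proof. by case: nu => -[//|n] e ni; rewrite (Estar_edgeE e ni); eexists. Qed.

Lemma Estar_edge_ge nu i : (projT1 nu <= i)%N -> Estar_edge nu i = None.
Proof. by case: nu => -[//|n] e /= ni; rewrite insubF// ltnNge ni. Qed.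

Lemma Estar_eq nu nu' : projT1 nu = projT1 nu' -> Estar_r nu = Estar_r nu' ->
  (forall i, (i < projT1 nu)%N -> Estar_edge nu i = Estar_edge nu' i) -> nu = nu'.
Proof.
case: nu nu' => n e [m e'] nm; change (n = m) in nm; subst m.
case: n e e' => [|n] e e'; first by move=> /= [->].
move=> _ ee'; congr existT; apply: val_inj; apply/funext => i.
have := ee' i (ltn_ord i).
rewrite (Estar_edge_ord e) (Estar_edge_ord e').
by move=> [].
Qed.

Lemma Estar_pathlike nu : pathlike (Estar_r nu) (Estar_edge nu).
Proof.
case: nu => -[|n] e; first by [].
split=> [|f|i f].
- by have [f ->] := @Estar_edge_lt (path_of e) 0%N isT.
- by rewrite (Estar_edgeE e (ltn0Sn n)) => -[<-]; congr (rmap (val _ _)); exact: val_inj.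
- have [ni|ni] := leqP n.+1 i.+1; first by rewrite (@Estar_edge_ge (path_of e)).
  rewrite (Estar_edgeE e ni) => -[<-].
  exists (val (e : set_type (@composable _ _ _ G n.+1)) (Ordinal (ltnW ni))).
    exact: Estar_edgeE.
  by rewrite (set_valP (e : set_type (@composable _ _ _ G n.+1)) (Ordinal (ltnW ni)) (Ordinal ni)).
Qed.

Lemma Estar_dE nu s x : projT1 nu = size s ->
  pmem (Estar_r nu) (Estar_edge nu) s x -> val (Estar_d nu) x.
Proof.
case: nu => -[|n] e; first by case: s => // _ [v [<-]].
case: (lastP s) => // {}s a; rewrite size_rcons => -[ns].
move=> /pmem_rcons[f [+ _]]; rewrite -ns (Estar_edgeE e (ltnSn n)) => -[<-].
by congr (val (dmap (val _ _)) _); exact: val_inj.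
Qed.

Lemma Estar_word nu : exists s x, projT1 nu = size s /\ pmem (Estar_r nu) (Estar_edge nu) s x.
Proof.
have rE := Estar_pathlike nu; case n0 : (projT1 nu) => [|n].
  have [|x rx] := pathlike_root rE; first by rewrite Estar_edge_ge ?n0.
  by exists [::], x.
have [|e nue] := @Estar_edge_lt nu n; first by rewrite n0.
by have [s [x [sn sx]]] := pathlike_edge rE nue; exists s, x.
Qed.

Lemma Estar_d_pmem nu x : val (Estar_d nu) x ->
  exists2 s, projT1 nu = size s & pmem (Estar_r nu) (Estar_edge nu) s x.
Proof.
have [s [y [nus sy]]] := Estar_word nu => dx; exists s => //.
case: nu nus sy dx => -[|n] e; first by case: s => // _ _ dx; exists e.
case: (lastP s) => // {}s a; rewrite size_rcons => -[ns] sy.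
apply: (pmem_last sy); rewrite -ns (Estar_edgeE e (ltnSn n)).
by congr (Some (val _ _)); exact: val_inj.
Qed.

Lemma Estar_exists r E s x : pathlike r E -> pmem r E s x ->
  exists nu, [/\ projT1 nu = size s, Estar_r nu = r &
    forall i, (i < size s)%N -> Estar_edge nu i = E i].
Proof.
move=> rE sx; have E_s i : (i < size s)%N -> exists e, E i = Some e by exact: pmem_edge sx.
case: s sx E_s => [[v rv _] _|a s sx E_s]; first by exists (vertex v); rewrite rv.
have [f fE] : exists f : nat -> E1 G, forall i, (i < size (a :: s))%N -> E i = Some (f i).
  have [e0 _] := E_s 0%N isT.
  exists (fun i => odflt e0 (E i)) => i /E_s[e ->]; by [].
have comp : (fun i : 'I_(size s).+1 => f i) \in @composable _ _ _ G (size s).+1.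
  rewrite inE => i j ij; have [_ _ /(_ i (f j))] := rE.
  rewrite -{1}ij fE// => /(_ erefl)[e]; rewrite fE//.
  by move=> [->].
pose e : En G (size s).+1 := exist (fun e => e \in @composable _ _ _ G (size s).+1) _ comp.
exists (path_of e); split=> //.
- by have [_ rE0 _] := rE; rewrite -(rE0 (f 0%N)) ?fE.
- by move=> i si; rewrite (Estar_edgeE e si) fE.
Qed.

(** * Boundary paths as sequences of edges *)

Lemma boundary_pathlike mu : pathlike (boundary_r mu) (boundary_edge mu).
Proof.
case: mu => [e|nu] /=; last exact: Estar_pathlike.
split=> [//|f [<-]//|i f [<-]]; exists (val e i) => //.
by rewrite (set_valP e).
Qed.

Lemma boundary_eq mu mu' : boundary_r mu = boundary_r mu' ->
  boundary_edge mu = boundary_edge mu' -> mu = mu'.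
Proof.
case: mu mu' => [e|nu] [e'|nu'] /= rr' ee'.
- congr inl; apply: val_inj; apply/funext => i.
  by have := congr1 (@^~ i) ee' => -[].
- by have := congr1 (@^~ (projT1 (val nu'))) ee'; rewrite /= Estar_edge_ge.
- by have := congr1 (@^~ (projT1 (val nu))) ee'; rewrite /= Estar_edge_ge.
- change (Estar_edge (val nu) = Estar_edge (val nu')) in ee'.
  congr inr; apply: val_inj; apply: Estar_eq => // [|i _]; last by rewrite ee'.
  apply/eqP; rewrite eqn_leq; apply/andP; split; rewrite leqNgt; apply/negP.
    by move=> /Estar_edge_lt[f]; rewrite ee' Estar_edge_ge.
  by move=> /Estar_edge_lt[f]; rewrite -ee' Estar_edge_ge.
Qed.

Lemma boundary_singular_end mu : singular_end (boundary_r mu) (boundary_edge mu).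
Proof.
case: mu => [e|nu] s x sx //= nus.
have /E0_sgP := set_valP nu; apply; apply: (Estar_dE _ sx).
apply/eqP; rewrite eqn_leq; apply/andP; split; rewrite leqNgt; apply/negP.
  by move=> /Estar_edge_lt[f]; rewrite nus.
by move=> h; have [f] := pmem_edge sx h; rewrite /= Estar_edge_ge.
Qed.

Lemma boundary_exists r E : pathlike r E -> singular_end r E ->
  exists mu, boundary_r mu = r /\ boundary_edge mu = E.
Proof.
move=> rE sE; have [[n En]|nE] := pselect (exists n, E n = None); last first.
  have {}nE i : exists e, E i = Some e.
    by case Ei : (E i) => [e|]; [exists e|case: nE; exists i].
  have [f fE] := choice nE.
  have fEinf : f \in Einf G.
    rewrite inE => i; have [_ _ /(_ i (f i.+1) (fE _))[e]] := rE.
    by rewrite fE => -[->].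
  exists (inl (exist (fun e => e \in Einf G) _ fEinf)); split=> /=.
    by have [_ rE0 _] := rE; rewrite (rE0 (f 0%N)).
  by apply/funext => i; rewrite fE.
have E_le i : E i = None -> forall j, (i <= j)%N -> E j = None.
  move=> Ei; elim=> [|j IH]; first by rewrite leqn0 => /eqP <-.
  rewrite leq_eqVlt => /orP[/eqP <-//|]; rewrite ltnS => /IH Ej.
  by case Ej1 : (E j.+1) => [e|//]; have [_ _ /(_ _ _ Ej1)[e']] := rE; rewrite Ej.
(* Descending from [n] finds the exact length of the path, together with the word labelling all of
   it. *)
have [s [x [sx Es]]] : exists s x, pmem r E s x /\ E (size s) = None.
  elim: n En => [|n IH] En; first by have [x rx] := pathlike_root rE En; exists [::], x.
  case En' : (E n) => [e|]; last exact: IH.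
  by have [s [x [ns sx]]] := pathlike_edge rE En'; exists s, x; rewrite ns.
have [nu [nus nur nuE]] := Estar_exists rE sx.
have nuEE : Estar_edge nu = E.
  apply/funext => i; have [si|/nuE//] := leqP (size s) i.
  by rewrite (E_le _ Es i si) Estar_edge_ge ?nus.
have nuB : nu \in boundary_finite G.
  rewrite inE; apply/E0_sgP => y /Estar_d_pmem[t nut]; rewrite nur nuEE => ty.
  by apply: (sE t) => //; rewrite -nut nus.
by exists (inr (exist (fun nu => nu \in boundary_finite G) _ nuB)).
Qed.

(** Comparing the ranges covers the paths of length 0, which have no edges. *)
Definition beginning nu mu : Prop := Estar_r nu = boundary_r mu /\
  forall i, (i < projT1 nu)%N -> Estar_edge nu i = boundary_edge mu i.

Lemma ZsetP (Q : set (Estar G)) mu : Zset Q mu <-> exists2 nu, Q nu & beginning nu mu.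
Proof.
split=> [[[v rv Qv]|[n [nu [nue Qnu]]]]|[[[|n] nu] Qnu [nur nue]]].
- by exists (vertex v); rewrite // /beginning rv.
- exists (path_of nu) => //.
  have nue' i : (i < n.+1)%N -> Estar_edge (path_of nu) i = boundary_edge mu i.
    by move=> ni; exact/esym/(nue (Ordinal ni)).
  split=> //; have [e e0] := @Estar_edge_lt (path_of nu) 0%N isT.
  have [_ /(_ _ e0) <- _] := Estar_pathlike (path_of nu).
  rewrite nue' in e0 => //.
  by have [_ /(_ _ e0) <- _] := boundary_pathlike mu.
- by left; exists nu.
- by right; exists n, nu; split=> // i; rewrite -nue.
Qed.

Lemma beginning_pmem nu mu s x : beginning nu mu -> projT1 nu = size s ->
  pmem (Estar_r nu) (Estar_edge nu) s x <-> pmem (boundary_r mu) (boundary_edge mu) s x.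
Proof. by move=> [-> nue] nus; apply: pmem_ext => i si; apply: nue; rewrite nus. Qed.

(** * Cylinders as compact open sets of finite paths *)

Definition cylinder s x : set (Estar G) :=
  [set nu | projT1 nu = size s /\ pmem (Estar_r nu) (Estar_edge nu) s x].

Lemma Zset_cylinder s x mu :
  Zset (cylinder s x) mu <-> pmem (boundary_r mu) (boundary_edge mu) s x.
Proof.
rewrite ZsetP; split=> [[nu [nus sx] numu]|sx]; first exact/(beginning_pmem _ numu nus).
have [nu [nus nur nue]] := Estar_exists (boundary_pathlike mu) sx.
have numu : beginning nu mu by split=> // i; rewrite nus; exact: nue.
by exists nu => //; split=> //; exact/(beginning_pmem _ numu nus).
Qed.

(** Induction on the word. The upward closure of [F] in the ideal of the shorter word gives a path,
    whose range [v] contains an element [C] of the ideal of [a]; restricting [v] to that ideal gives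
    an edge to prepend. *)
Lemma ultra_pathlike s F : ultra G s F ->
  exists r E, pathlike r E /\
    forall x, ideal_word G s x -> pmem r E s x <-> F x.
Proof.
elim: s F => [|a s IH] F FU.
  pose v : E0 G := exist (fun F => F \in ultra G [::]) _ (mem_set FU).
  exists (Some v), (fun=> None); split=> // x _ /=.
  by split=> [[w [<-]]//|Fx]; exists v.
have [[FJ [x0 Fx0] _ _ _] _] := FU.
have JJ := @ideal_word_behead _ _ _ G a s.
have [r' [E' [rE' sF]]] := IH _
  (ultra_up (ideal_word_ideal G (a :: s)) (ideal_word_ideal G s) JJ FU).
have [C JC x0C] := FJ _ Fx0.
have sx0 : pmem r' E' s x0.
  by apply/sF; [exact/JJ/FJ|split; [exact/JJ/FJ|exists x0]].
have [v r'v vC] := @pmem_theta _ _ _ G r' E' [::] s C rE' (pmem_le sx0 x0C).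
have eU : ultra G [:: a] (val v `&` ideal_word G [:: a]).
  apply: ultra_restr (ideal_word_ideal G _) (ideal_word_ideal G [::]) _ (set_valP v) _ => //.
  by exists C => //; rewrite ideal_word1.
pose eF : uspace G [:: a] := exist (fun F => F \in ultra G [:: a]) _ (mem_set eU).
pose e : E1 G := existT (fun a => uspace G [:: a]) a eF.
have ev : dmap e = v.
  apply: val_inj; apply: ultra_eq (set_valP (dmap e)) (set_valP v) _ => x [y [vy _] yx].
  exact: ultra_le (set_valP v) vy I yx.
have [r'0 r'E r'S] := rE'.
exists (rmap e), (fun i => if i is j.+1 then E' j else Some e); split.
  split=> [//|f [<-]//|[|i] f]; last exact: r'S.
  by move=> /r'E fr'; exists e => //; rewrite fr' ev.
move=> x Jx /=.
have -> : (exists f, [/\ Some e = Some f, projT1 f = a &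
    pmem (Some (dmap f)) (tail (fun i => if i is j.+1 then E' j else Some e)) s x]) <->
    pmem r' E' s x.
  by rewrite r'v -ev; split=> [[f [[<-]]]//|sx]; exists e.
rewrite sF; last exact: JJ.
split=> [[_ [y Fy yx]]|Fx]; first exact: ultra_le FU Fy Jx yx.
by split; [exact: JJ|exists x].
Qed.

Lemma continuous_initial (X : topologicalType) (S : choiceType) (T : topologicalType)
  (f : S -> T) (g : X -> initial_topology f) : continuous (f \o g) -> continuous g.
Proof.
move=> /continuousP fg; apply/continuousP => A [C oC <-].
by rewrite -comp_preimage; exact: fg.
Qed.

Lemma continuous_ptws (X V : topologicalType) (U : Type) (g : X -> {ptws U -> V}) :
  (forall u, continuous (fun p => g p u)) -> continuous g.
Proof.
move=> gu p; apply/cvg_sup => u.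
by apply: (@continuous_initial X _ V (fun f : U -> V => f u) g); exact: gu.
Qed.

Definition labelled_path s (F : uspace G s) (e : En G (size s)) : Prop :=
  forall y, ideal_word G s y ->
    pmem (Estar_r (existT _ (size s) e)) (Estar_edge (existT _ (size s) e)) s y <-> val F y.

Lemma labelled_path_exists s (F : uspace G s) : exists e, labelled_path F e.
Proof.
have [[FJ [x0 Fx0] _ _ _] _] := set_valP F.
have [r [E [rE sF]]] := ultra_pathlike (set_valP F).
have sx0 : pmem r E s x0 by apply/sF => //; exact: FJ.
have [[n e] [ns nur nue]] := Estar_exists rE sx0; change (n = size s) in ns; subst n.
exists e => y Jy; rewrite -sF//.
by rewrite nur; exact: pmem_ext.
Qed.

(** A neighbourhood of the edge at [i] is given by its letter and an element [x] of its vertex.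
    Moving [x] to the end of the word and shrinking it into the ideal gives a basic neighbourhood of
    [F] that works. *)
Lemma labelled_path_continuous s (k : uspace G s -> En G (size s)) :
  (forall F, labelled_path F (k F)) -> continuous k.
Proof.
case: s k => [|a s] k kP.
  move=> F U /uspace_nbhsP[x [Jx kx xU]]; apply/uspace_nbhsP; exists x; split=> //.
    by apply/(kP F) => //; exists (k F).
  by move=> F' F'x; apply: xU; have [w [<-]] := (kP F' x Jx).2 F'x.
apply: (@continuous_initial _ _ _ (set_val : set_type (@composable _ _ _ G (size s).+1) -> _)).
apply: continuous_ptws => i F U /edge_nbhsP[x [Jx ex xU]].
pose r F' := Estar_r (path_of (k F')); pose E F' := Estar_edge (path_of (k F')).
have kE F' : E F' i = Some (val (k F' : set_type (@composable _ _ _ G (size s).+1)) i).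
  exact: Estar_edge_ord.
have kp F' : pathlike (r F') (E F') by exact: Estar_pathlike.
have {}kP F' y : ideal_word G (a :: s) y -> pmem (r F') (E F') (a :: s) y <-> val F' y.
  exact: kP.
have [t [z [ti tz]]] := pathlike_edge (kp F) (kE F).
have [[FJ [y0 Fy0] _ _ _] _] := set_valP F.
have sy0 := (kP F y0 (FJ _ Fy0)).2 Fy0.
have [|u su] := pmem_comparable tz sy0; first by rewrite ti /=; exact: ltn_ord.
case/lastP: t => [//|t b] in ti tz su *; rewrite size_rcons in ti; case: ti => ti.
have [e [+ eb _]] := pmem_rcons tz; rewrite ti kE => -[ee].
have Et : E F (size t) = Some (val (k F : set_type (@composable _ _ _ G (size s).+1)) i).
  by rewrite ti kE.
have tx := pmem_last tz Et ex.
rewrite su in sy0; have [y [Jy yx sy]] := pmem_ideal_le (kp F) (theta_pmem (kp F) tx sy0).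
rewrite -su in Jy sy; apply/uspace_nbhsP; exists y; split=> //; first exact/(kP F).
move=> F' F'y; have s'y := (kP F' y Jy).2 F'y; rewrite su in s'y.
have [e' [+ e'b e'x]] := pmem_rcons (pmem_theta (kp F') (pmem_le s'y yx)).
rewrite ti kE => -[e'E]; suff : U e' by rewrite -e'E.
by apply: xU => //; rewrite e'b -eb -ee.
Qed.

(** By [pmem_inj] a path labelled [s] is determined by the ultrafilter at its end; compactness and
    bases thus pass from ultrafilters to cylinders. *)
Lemma cylinder_image s : exists2 k : uspace G s -> Estar G, continuous k &
  forall x, ideal_word G s x -> cylinder s x = k @` ubase x.
Proof.
have [k kP] := choice (@labelled_path_exists s).
exists (fun F => existT _ (size s) (k F)).
  move=> F U; exact: (labelled_path_continuous kP).
move=> x Jx; apply/seteqP; split=> [nu [nus sx]|_ [F Fx <-]]; last first.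
  by split=> //; exact/(kP F).
have FU := pmem_ultra (Estar_pathlike nu) sx.
pose F : uspace G s := exist (fun F => F \in ultra G s) _ (mem_set FU).
exists F => //; apply/esym.
have [] := pmem_inj (Estar_pathlike nu) (Estar_pathlike (existT _ (size s) (k F))) sx _.
  by move=> y Jy; rewrite (kP F y Jy); split=> [|[]].
by move=> rr ee; apply: Estar_eq => // i; rewrite nus; exact: ee.
Qed.

Lemma cylinder_compact s x : ideal_word G s x -> compact (cylinder s x).
Proof.
move=> Jx; have [k kc ->//] := cylinder_image s.
by apply: continuous_compact; [exact: continuous_subspaceT|exact: ubase_compact].
Qed.

Lemma cylinder_base nu U : nbhs nu U ->
  exists s x, [/\ ideal_word G s x, cylinder s x nu & cylinder s x `<=` U].
Proof.
have [s [y [nus sy]]] := Estar_word nu.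
have [x [Jx _ sx]] := pmem_ideal_le (Estar_pathlike nu) sy.
have [k kc kE] := cylinder_image s.
have [F Fx <-] : (k @` ubase x) nu by rewrite -kE.
move=> nU; have [z [Jz Fz zU]] := (uspace_nbhsP F _).1 (kc F U nU).
exists s, z; split=> //; first by rewrite kE//; exact: imageP.
by rewrite kE// => _ [F' F'z <-]; exact: zU.
Qed.

Lemma edge_dset_nbhs (e : E1 G) x : dset e x ->
  nbhs e [set e' | projT1 e' = projT1 e /\ dset e' x].
Proof.
move=> [z ez zx]; have [[FJ _ _ _ _] _] := set_valP (projT2 e).
apply/edge_nbhsP; exists z; split; [by rewrite -ideal_word1; exact: FJ|by exists z|].
by move=> e' e'e [u e'u uz]; split=> //; exists u => //; exact: le_trans zx.
Qed.

(** A path has finitely many edges and their letters are locally constant; near the path also the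
    last vertex keeps [x], and [pmem_labels] applies. *)
Lemma cylinder_open s x : open (cylinder s x).
Proof.
apply/sigT_openP => n; rewrite openE => e [ns sx]; change (n = size s) in ns.
case: n e ns sx => [|n] e ns sx.
  case: s ns sx => // _ [v [<-] ex]; apply/uspace_nbhsP; exists x; split=> // w wx.
  by split=> //; exists w.
pose p (e : En G n.+1) : {ptws 'I_n.+1 -> E1 G} := val (e : set_type (@composable _ _ _ G n.+1)).
have pi_near i U : nbhs (p e i) U -> nbhs e [set e' | U (p e' i)].
  have pc : continuous (set_val : set_type (@composable _ _ _ G n.+1) -> _).
    exact: initial_continuous.
  move=> /(@proj_continuous _ (fun=> E1 G) i (p e)); exact: pc.
have eE e' i : Estar_edge (path_of e') (nat_of_ord i) = Some (p e' i) := Estar_edge_ord e' i.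
case: (lastP s) ns sx => [//|{}s a]; rewrite size_rcons => -[ns] sx.
have [f [sf fa fx]] := pmem_rcons sx.
have fE : f = p e ord_max.
  by rewrite -ns in sf; have [] := etrans (esym sf) (eE e ord_max).
have label_near : \forall e' \near e, forall i, projT1 (p e' i) = projT1 (p e i).
  apply: (@filter_forall _ _ (fun i e' => projT1 (p e' i) = projT1 (p e i)) _
    (nbhs_filter e)) => i; have [[_ [z Fz] _ _ _] _] := set_valP (projT2 (p e i)).
  have /edge_dset_nbhs/pi_near : dset (p e i) z by exists z.
  by apply: filterS => e' [].
rewrite fE in fx; move: (pi_near _ _ (edge_dset_nbhs fx)) label_near.
apply: filterS2 => e' [_ e'x] e'e; split; first by rewrite /= size_rcons ns.
apply: (pmem_labels _ sx); last first.
  by exists (p e' ord_max) => //; rewrite -ns; exact: (eE e' ord_max).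
move=> i; rewrite -ns -ltnS => ni; rewrite (eE e (Ordinal ni)) (eE e' (Ordinal ni)) /=.
by rewrite e'e.
Qed.

(** * The bijection between boundary paths and tight filters *)

Definition filter_of mu : set (@triple disp B L) :=
  pathlike_filter (boundary_r mu) (boundary_edge mu).

Lemma filter_of_tight mu : filter_of mu \in tight G.
Proof.
by rewrite inE; apply: path_tight; [exact: boundary_pathlike|exact: boundary_singular_end].
Qed.

Definition tight_of mu : tight_spectrum G :=
  exist (fun xi => xi \in tight G) _ (filter_of_tight mu).

Lemma tight_of_idem mu s x : val (tight_of mu) (idem s x) <->
  ideal_word G s x /\ pmem (boundary_r mu) (boundary_edge mu) s x.
Proof. exact: pathlike_filter_idem. Qed.

Lemma tight_eq (xi xi' : tight_spectrum G) :
  (forall s x, val xi (idem s x) <-> val xi' (idem s x)) -> xi = xi'.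
Proof.
move=> h; apply: val_inj; apply/seteqP; split=> e xie.
  have [s [x [_ _ eE]]] := efilter_idem (tight_efilter (set_valP xi)) xie.
  by rewrite eE in xie *; exact/h.
have [s [x [_ _ eE]]] := efilter_idem (tight_efilter (set_valP xi')) xie.
by rewrite eE in xie *; exact/h.
Qed.

Lemma tight_of_inj : injective tight_of.
Proof.
move=> mu mu' mm; have [] := pathlike_inj (boundary_pathlike mu) (boundary_pathlike mu').
  move=> s x Jx; have := tight_of_idem mu s x; rewrite mm tight_of_idem.
  by move=> [h1 h2]; split=> h; [have [] := h2 (conj Jx h)|have [] := h1 (conj Jx h)].
exact: boundary_eq.
Qed.

Lemma tight_of_surj xi : exists mu, tight_of mu = xi.
Proof.
have xiT := set_valP xi.
have [mu [mur muE]] := boundary_exists (tight_pathlike xiT) (tight_singular_end xiT).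
exists mu; apply: tight_eq => s x; rewrite tight_of_idem mur muE.
split=> [[Jx]|xix]; first by move/(tight_pmem xiT Jx).
have [_ Jx] := efilter_idemP (tight_efilter xiT) xix.
by split=> //; exact/tight_pmem.
Qed.

End BoundaryPaths.
Arguments cylinder {disp B L} G s x.

(** * The homeomorphism *)

Section Homeomorphism.
Context {disp : Order.disp_t} {B : cbDistrLatticeType disp} {L : choiceType}.
Local Open Scope classical_set_scope.
Variable G : gbds B L.
Implicit Types (s t : seq L) (x y : B).
Implicit Types (nu : Estar G) (mu : boundary G) (xi : tight_spectrum G).

(** * Continuity in both directions *)

Lemma boundary_open U K : open U -> compact K ->
  open (Zset U `&` ~` Zset K : set (boundary G)).
Proof.
move=> oU cK.
exists [set Zset U `&` ~` Zset K]; last by rewrite bigcup_set1.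
move=> _ ->; exists [fset ((U, K) : set (Estar G) * set (Estar G))]%fset.
  by move=> UK; rewrite !inE => /eqP ->.
by rewrite set_fset1 bigcap_set1.
Qed.

Lemma boundary_nbhs mu (W : set (boundary G)) : nbhs mu W ->
  exists2 D : {fset set (Estar G) * set (Estar G)},
    (forall UK, UK \in D -> [/\ open UK.1, compact UK.2 & (Zset UK.1 `&` ~` Zset UK.2) mu]) &
    \bigcap_(UK in [set` D]) (Zset UK.1 `&` ~` Zset UK.2) `<=` W.
Proof.
rewrite nbhsE => -[V [[D' D'D <-] [A D'A Amu]] VW].
have [D DD AE] := D'D _ D'A; exists D; last first.
  by apply: subset_trans VW => mu' h; exists A => //; rewrite -AE.
move=> UK UKD; have := DD _ UKD; rewrite inE => -[oU cK]; split=> //.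
by rewrite -AE in Amu; exact: Amu.
Qed.

(** Cylinders are open, and compact for [x] in the ideal, so each can serve as [U] with [K] empty,
    or as [K] with [U] all finite paths. *)
Lemma Zset_cylinder_clopen s x : ideal_word G s x ->
  open (Zset (cylinder G s x)) /\ open (~` Zset (cylinder G s x)).
Proof.
move=> Jx; split.
  suff -> : Zset (cylinder G s x) = Zset (cylinder G s x) `&` ~` Zset set0.
    by apply: boundary_open; [exact: cylinder_open|exact: compact0].
  by apply/seteqP; split=> [mu h|mu []//]; split=> // /ZsetP[].
suff -> : ~` Zset (cylinder G s x) = Zset setT `&` ~` Zset (cylinder G s x).
  by apply: boundary_open; [exact: openT|exact: cylinder_compact].
apply/seteqP; split=> [mu h|mu []//]; split=> //; apply/ZsetP.
case E0 : (boundary_edge mu 0) => [e|].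
  have [t [y [_ ty]]] := pathlike_edge (boundary_pathlike mu) E0.
  by have [nu _ ?] := (ZsetP _ _).1 ((Zset_cylinder _ _ _).2 ty); exists nu.
have [y ry] := pathlike_root (boundary_pathlike mu) E0.
by have [nu _ ?] := (ZsetP _ _).1 ((Zset_cylinder _ _ _).2 ry); exists nu.
Qed.

(** Each coordinate of the characteristic function is the indicator of a clopen set of boundary
    paths. *)
Lemma tight_of_continuous : continuous (@tight_of _ _ _ G).
Proof.
apply: (@continuous_initial _ _ _ (@charfun _ _ _ G)).
apply: continuous_ptws => e.
pose P mu := val (tight_of mu) (val e).
suff [oP oNP] : open P /\ open (~` P).
  move=> mu U; have [Pmu|nPmu] := pselect (P mu).
    rewrite /= /charfun asboolT// => /nbhs_singleton Ut.
    apply: filterS (open_nbhs_nbhs (conj oP Pmu)) => mu' Pmu'.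
    by rewrite /preimage /= asboolT.
  rewrite /= /charfun asboolF// => /nbhs_singleton Uf.
  apply: filterS (open_nbhs_nbhs (conj oNP nPmu)) => mu' Pmu'.
  by rewrite /preimage /= asboolF.
have [e0|[s [x [x0 Jx eE]]]] := set_valP e.
  suff -> : P = set0 by split; [exact: open0|rewrite setC0; exact: openT].
  apply/seteqP; split=> // mu; rewrite /P e0.
  by have [_ _ _ _ h] := tight_efilter (set_valP (tight_of mu)) => /h.
have -> : P = Zset (cylinder G s x).
  apply/seteqP; split=> mu; rewrite /P eE tight_of_idem Zset_cylinder; first by case.
  by move=> ?; split.
exact: Zset_cylinder_clopen.
Qed.

Lemma tight_nbhs xi s x : ideal_word G s x -> x != \bot ->
  (val xi (idem s x) -> \forall xi' \near xi, val xi' (idem s x)) /\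
  (~ val xi (idem s x) -> \forall xi' \near xi, ~ val xi' (idem s x)).
Proof.
move=> Jx x0.
have eI : idem s x \in idempotents G by rewrite inE; right; exists s, x.
pose e : set_type (idempotents G) := exist (fun e => e \in idempotents G) _ eI.
have cont : {for xi, continuous (fun xi' : tight_spectrum G => charfun xi' e)}.
  apply: (@continuous_comp _ _ _ (@charfun _ _ _ G) (fun f => f e)).
    exact: initial_continuous.
  exact: (@proj_continuous _ (fun=> bool) e).
have near_eq : nbhs xi [set xi' : tight_spectrum G | charfun xi' e = charfun xi e].
  exact: cont _ (discrete_set1 _).
split=> h; apply: filterS near_eq => xi'; rewrite /= /charfun /=.
  by rewrite [RHS]asboolT// => /asboolP.
by rewrite [RHS]asboolF// => /asboolPn.
Qed.

Section Inverse.
Variable phi : tight_spectrum G -> boundary G.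
Hypotheses (phiK : cancel phi (@tight_of _ _ _ G)).

Let phi_pmem xi s x : ideal_word G s x ->
  pmem (boundary_r (phi xi)) (boundary_edge (phi xi)) s x <-> val xi (idem s x).
Proof. by move=> Jx; rewrite -{3}(phiK xi) tight_of_idem; split=> [//|[]]. Qed.

Lemma Zset_near xi U : open U -> Zset U (phi xi) ->
  \forall xi' \near xi, Zset U (phi xi').
Proof.
move=> oU /ZsetP[nu Unu bnu].
have [s [x [Jx sx sU]]] := cylinder_base (open_nbhs_nbhs (conj oU Unu)).
have xix : val xi (idem s x).
  by apply/phi_pmem => //; apply/(beginning_pmem _ bnu) => //; case: sx.
have x0 := pmem_neq0 sx.2.
apply: filterS ((tight_nbhs xi Jx x0).1 xix) => xi' xi'x.
move/phi_pmem : xi'x => /(_ Jx)/Zset_cylinder/ZsetP[nu' snu' bnu'].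
by apply/ZsetP; exists nu' => //; exact: sU.
Qed.

(** A path [nu] in [K] that is not a beginning of [phi xi] differs from it, at the word of [nu], in
    some [z]. This separates neighbourhoods of [nu] and of [xi], and compactness of [K] makes one
    neighbourhood of [xi] suffice. *)
Lemma ZsetC_near xi K : compact K -> ~ Zset K (phi xi) ->
  \forall xi' \near xi, ~ Zset K (phi xi').
Proof.
move=> cK nK.
have cov nu : K nu ->
    \forall nu' \near nu & xi' \near xi, ~ beginning nu' (phi xi').
  move=> Knu; have [s [y [Jy [nus sy] _]]] := cylinder_base (@filterT _ (nbhs nu) _).
  have [z Jz [nuz|[xiz nuz]]] : exists2 z, ideal_word G s z &
      (cylinder G s z nu /\ ~ val xi (idem s z)) \/
      (val xi (idem s z) /\ ~ cylinder G s z nu).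
    apply: contrapT => nex; apply: nK; apply/ZsetP; exists nu => //.
    have [] := pmem_inj (Estar_pathlike nu) (boundary_pathlike (phi xi)) sy.
      move=> z Jz; rewrite phi_pmem//; split=> h.
        by apply: contrapT => nh; apply: nex; exists z => //; left; split=> //; split.
      apply: contrapT => nh; apply: nex; exists z => //; right; split=> //.
      by move=> [].
    by rewrite -nus => rr ee; split.
  - have z0 := pmem_neq0 nuz.1.2.
    exists (cylinder G s z, [set xi' | ~ val xi' (idem s z)]) => /=.
      split; last by apply: (tight_nbhs xi Jz z0).2; exact: nuz.2.
      by apply: open_nbhs_nbhs; split; [exact: cylinder_open|exact: nuz.1].
    move=> [nu' xi'] /= [[nu's nu'z] nxi'] bnu'; apply: nxi'.
    by apply/phi_pmem => //; apply/(beginning_pmem _ bnu').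
  - have z0 : z != \bot by have [] := efilter_idemP (tight_efilter (set_valP xi)) xiz.
    (* Here [z] is missing from the last vertex of [nu], so that vertex contains the difference of
       [y] and [z], which is disjoint from [z]. *)
    exists (cylinder G s (y `\` z)%O, [set xi' | val xi' (idem s z)]) => /=.
      split; last by apply: (tight_nbhs xi Jz z0).1.
      apply: open_nbhs_nbhs; split; first exact: cylinder_open.
      split=> //; have [syz|//] := pmem_split z sy.
      by case: nuz; split=> //; apply: pmem_le syz (leIr _ _).
    move=> [nu' xi'] /= [[nu's nu'yz] xi'z] bnu'.
    move/(beginning_pmem _ bnu' nu's) : nu'yz => h.
    have := pmemI h ((phi_pmem xi' Jz).2 xi'z) => /pmem_neq0.
    by rewrite diffIK eqxx.
have := (compact_near_coveringP _).1 cK _ (nbhs xi)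
  (fun xi' nu => ~ beginning nu (phi xi')) (nbhs_filter xi) cov.
by apply: filterS => xi' h /ZsetP[nu /h].
Qed.

Lemma inverse_continuous : continuous phi.
Proof.
move=> xi W /boundary_nbhs[D DP DW]; apply: filterS (_ : nbhs xi (\bigcap_(UK in [set` D])
  (phi @^-1` (Zset UK.1 `&` ~` Zset UK.2)))) => [xi' h|].
  by apply: DW => UK /h.
apply: filter_bigI => UK /DP[oU cK [Uxi Kxi]].
by apply: filterI; [exact: Zset_near|exact: ZsetC_near].
Qed.

End Inverse.

(** * Compatibility with the shifts *)

Lemma Estar_shift_edge nu i : (0 < projT1 nu)%N ->
  Estar_edge (Estar_shift nu) i = Estar_edge nu i.+1.
Proof.
case: nu => -[//|[|n]] e _; first by rewrite (@Estar_edge_ge _ _ _ G (path_of e)).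
rewrite [Estar_shift _]/=; have [ni|ni] := ltnP i n.+1.
  rewrite (Estar_edgeE _ ni) (Estar_edgeE e (ni : (i.+1 < n.+2)%N)) /=.
  by congr (Some (val e _)); exact: val_inj.
by rewrite !Estar_edge_ge.
Qed.

Lemma Estar_shift_path nu : (0 < projT1 nu)%N ->
  exists2 e, Estar_edge nu 0 = Some e &
    Estar_r (Estar_shift nu) = Some (dmap e) /\
    Estar_edge (Estar_shift nu) = tail (Estar_edge nu).
Proof.
move=> nu0; have [e nue] := Estar_edge_lt nu0; exists e => //.
have shE : Estar_edge (Estar_shift nu) = tail (Estar_edge nu).
  by apply/funext => i; rewrite Estar_shift_edge.
split=> //; case: nu nu0 nue shE => [[|[|n]] f] // _.
  rewrite (Estar_edgeE f (ltn0Sn 0)) => -[<-] _ /=.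
  by congr (Some (dmap (sval f _))); exact: val_inj.
have [_ _ nuS] := Estar_pathlike (path_of f).
have [g fg] := @Estar_edge_lt _ _ _ G (path_of f) 1 isT.
move=> fe shE; have [e' + ge'] := nuS _ _ fg; rewrite fe => -[ee'].
have [_ + _] := Estar_pathlike (Estar_shift (path_of f)).
by move=> /(_ g) <-; rewrite ?shE// ge' ee'.
Qed.

Lemma boundary_shift_path (mu : boundary_positive G) :
  exists2 e, boundary_edge (val mu) 0 = Some e &
    boundary_r (boundary_shift mu) = Some (dmap e) /\
    boundary_edge (boundary_shift mu) = tail (boundary_edge (val mu)).
Proof.
have := set_valP mu; rewrite /boundary_shift; case: (val mu) => [e _|nu nuP].
  by exists (val e 0%N) => //; split=> //=; rewrite (set_valP e).
apply: (@Estar_shift_path (val nu)).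
by case nuE : (val nu) => [[|n] e] //; case: nuP; exists nu, e.
Qed.

(** Membership at [s] after the shift is membership at [b :: s] before it. [pmem_ideal] supplies a
    smaller element in the ideal of [b :: s], as the shift of a filter asks for. *)
Lemma tight_of_shift (mu : boundary_positive G) (xi : tight_spectrum1 G) :
  tight_of (val mu) = val xi -> tight_of (boundary_shift mu) = sigma xi.
Proof.
move=> muxi; apply: tight_eq => s x.
have xiF := tight_efilter (set_valP (val xi)).
have muP := boundary_pathlike (val mu).
have [e mue [shr shE]] := boundary_shift_path mu.
rewrite tight_of_idem shr shE.
have xi_pmem t y : val (val xi) (idem t y) <-> ideal_word G t y /\
    pmem (boundary_r (val mu)) (boundary_edge (val mu)) t y.
  by rewrite -muxi; exact: tight_of_idem.
have [b [y yb]] : exists b y, val (val xi) (idem [:: b] y).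
  have [t [u [+ tu]]] := pathlike_edge muP mue.
  have [y [Jy _ ty]] := pmem_ideal_le muP tu.
  by case: t tu Jy ty => [|b [|c t]] //; exists b, y; exact/xi_pmem.
have [_ [e' [+ e'b _]]] := (xi_pmem _ _).1 yb; rewrite mue => -[ee']; subst e'.
rewrite /sigma /= (shift_idem _ _ xiF yb); split=> -[Jx].
  move=> sx; split=> //.
  have [|w [Jw wx bw]] := @pmem_ideal _ _ _ G _ _ b s x muP.
    by exists e.
  by exists w => //; exact/xi_pmem.
move=> [w /xi_pmem[_ [e'' []]]]; rewrite mue => -[<-] _ sw wx.
by split=> //; exact: pmem_le sw wx.
Qed.

Lemma tight_spectrum1_positive mu (xi : tight_spectrum1 G) :
  tight_of mu = val xi -> mu \in boundary_positive G.
Proof.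
move=> muxi; rewrite inE => -[nu [v [muE nuE]]].
have xiF := tight_efilter (set_valP (val xi)).
have [w xiw /word_consP[a [u wE]]] := set_valP xi.
have [t [x [xix t0]]] : exists t x, val (val xi) (idem t x) /\ (0 < size t)%N.
  rewrite wE in xiw; case: u {wE} xiw => [s|f] /=.
    by move=> [[x xix] _]; exists (a :: s), x.
  by move=> [h _]; exact: (h 1%N).
move: xix; rewrite -muxi tight_of_idem muE => -[_ /pmem_edge /(_ t0)[e]].
by rewrite /= nuE.
Qed.

End Homeomorphism.

Theorem theorem7p10 (disp : Order.disp_t) (B : cbDistrLatticeType disp)
    (L : choiceType) (G : gbds B L) :
  exists phi : tight_spectrum G -> boundary G,
    homeomorphism phi /\
    forall xi : tight_spectrum1 G,
      exists2 mu : boundary_positive G,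
        val mu = phi (val xi) & phi (sigma xi) = boundary_shift mu.
Proof.
(* [phi] is chosen as a right inverse of [tight_of]; injectivity of [tight_of] makes it
   two-sided. *)
have [phi phiK] := choice (@tight_of_surj _ _ _ G).
have tightK : cancel (@tight_of _ _ _ G) phi.
  by move=> mu; apply: tight_of_inj; exact: phiK.
exists phi; split.
  exists (@tight_of _ _ _ G); split=> //; first exact: inverse_continuous.
  exact: tight_of_continuous.
move=> xi; have mupos := tight_spectrum1_positive (phiK (val xi)).
exists (exist (fun mu => mu \in boundary_positive G) _ mupos) => //.
by rewrite -(tight_of_shift (mu := exist (fun mu => mu \in boundary_positive G) _ mupos))// phiK.
Qed.
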